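(* Let $m=p+q\ge3$. (1) Let $\Gamma_n\in\mathcal{W}(p,q)$ satisfy $\Gamma_n\to\Gamma\in\mathcal{W}(p,q)$. If $\dim\{G_{\Gamma_n}^+\}\ge1$, then $\dim\{G_\Gamma^+\}\ge1$. (2) There exists $c(m)$ so that if $\Gamma\in\mathcal{W}(p,q)$ and if no element of $G_\Gamma^+$ has infinite order, then every element in $G_\Gamma^+$ has order at most $c(m)$. Furthermore, $\lim_{m\to\infty}c(m)=\infty$.
   Context: $\mathcal{W}(m)=(\mathbb{R}^m)^*\otimes(\mathbb{R}^m)^*\otimes\mathbb{R}^m$ is the vector space of arrays $\Gamma=(\Gamma_{ij}{}^k)_{1\le i,j,k\le m}$ of real constants (constant Christoffel symbols on $\mathbb{R}^m$, torsion allowed). Repeated indices are summed. The Ricci tensor of $\Gamma$ is $\rho_{\Gamma,jk}=\Gamma_{in}{}^i\Gamma_{jk}{}^n-\Gamma_{jn}{}^i\Gamma_{ik}{}^n$, and the symmetric Ricci tensor is $\rho_{s,\Gamma,jk}=\frac12(\rho_{\Gamma,jk}+\rho_{\Gamma,kj})$. For $p+q=m$, $\mathcal{W}(p,q)$ is the set of $\Gamma\in\mathcal{W}(m)$ for which $\rho_{s,\Gamma}$ is non-degenerate with signature $(p,q)$: $p$ negative and $q$ positive directions. $\operatorname{GL}^+(m,\mathbb{R})$ is the group of linear maps of $\mathbb{R}^m$ with positive determinant. It acts on $\mathcal{W}(m)$ by $(T\Gamma)(e_i,e_j,e^k)=\Gamma(Te_i,Te_j,Te^k)$, where $\Gamma(e_i,e_j,e^k)=\Gamma_{ij}{}^k$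 and $T$ acts on covectors by the dual action (so that $\langle Te^k,Te_i\rangle=\delta^k_i$). Set $G_\Gamma^+:=\{T\in\operatorname{GL}^+(m,\mathbb{R}):T\Gamma=\Gamma\}$, a closed Lie subgroup of $\operatorname{GL}^+(m,\mathbb{R})$; $\dim$ is its dimension as a Lie group. *)

(* Defs.v *)
From HB Require Import structures.
From mathcomp Require Import all_boot all_order all_algebra.
From mathcomp Require Import all_classical all_reals all_analysis.

Set Implicit Arguments.
Unset Strict Implicit.
Unset Printing Implicit Defensive.

Import Order.TTheory GRing.Theory Num.Theory.
Import numFieldNormedType.Exports.

Local Open Scope classical_set_scope.
Local Open Scope ring_scope.

(** Constant Christoffel symbols on R^m: [Gam i j k] is Gamma_{ij}^k. *)
Definition christoffel (R : realType) (m : nat) := 'I_m -> 'I_m -> 'I_m -> R.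

Section Christoffel.
Context {R : realType} {m : nat}.
Implicit Types (Gam : christoffel R m) (T : 'M[R]_m).

Definition ricci Gam : 'M[R]_m :=
  \matrix_(j, k) \sum_i \sum_n
    (Gam i n i * Gam j k n - Gam j n i * Gam i k n).

Definition sym_ricci Gam : 'M[R]_m :=
  \matrix_(j, k) (2^-1 * (ricci Gam j k + ricci Gam k j)).

(** The rows of [P] are an orthonormal basis for the bilinear form [S], whose
    first [p] vectors are negative and whose last [q] vectors are positive. *)
Definition has_signature (p q : nat) (S : 'M[R]_m) : Prop :=
  (p + q = m)%N /\
  exists2 P : 'M[R]_m, P \in unitmx &
    P *m S *m P^T = diag_mx (\row_(i < m) (if (i < p)%N then -1 else 1)).

Definition W (p q : nat) : set (christoffel R m) :=
  [set Gam | sym_ricci Gam \in unitmx /\ has_signature p q (sym_ricci Gam)].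

(** [Gam] as a trilinear form. Vectors are columns, covectors are rows, and
    the pairing of a covector [w] with a vector [v] is [w *m v]. *)
Definition christoffel_form Gam (u v : 'cV[R]_m) (w : 'rV[R]_m) : R :=
  \sum_a \sum_b \sum_c u a 0 * v b 0 * w 0 c * Gam a b c.

(** The dual action of [T] on covectors is [w |-> w *m invmx T], so that
    [(w *m invmx T) *m (T *m v) = w *m v] for invertible [T]. *)
Definition act T Gam : christoffel R m := fun i j k =>
  christoffel_form Gam (T *m delta_mx i 0) (T *m delta_mx j 0)
    (delta_mx 0 k *m invmx T).

Definition Gplus Gam : set 'M[R]_m := [set T | 0 < \det T /\ act T Gam = Gam].

(** [G], with the topology induced from the space of matrices, is locally
    homeomorphic to R^d: [f] and [g] are mutually inverse homeomorphisms
    between the relatively open subset [G `&` U] and the open set [V]. *)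
Definition locally_euclidean (G : set 'M[R]_m) (d : nat) : Prop :=
  forall T, G T ->
  exists (U : set 'M[R]_m) (V : set 'rV[R]_d)
         (f : 'M[R]_m -> 'rV[R]_d) (g : 'rV[R]_d -> 'M[R]_m),
    [/\ open U /\ U T,
        open V,
        {within G `&` U, continuous f} /\ {within V, continuous g},
        forall x, (G `&` U) x -> V (f x) /\ g (f x) = x &
        forall y, V y -> (G `&` U) (g y) /\ f (g y) = y].

(** The dimension of a closed subgroup [G] of GL(m, R) as a manifold. A closed
    subgroup is an embedded Lie subgroup, so such a [d] exists, and it is unique
    by invariance of domain; the default value 0 is then irrelevant. *)
Definition lie_dim (G : set 'M[R]_m) : nat :=
  xget 0%N [set d | locally_euclidean G d].

Definition infinite_order T : Prop := forall n, (0 < n)%N -> T ^+ n <> 1.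

Definition has_order T (n : nat) : Prop :=
  [/\ (0 < n)%N, T ^+ n = 1 & forall k, (0 < k < n)%N -> T ^+ k <> 1].

End Christoffel.

(** [b] bounds the orders of the elements of the groups [Gplus Gam] without
    elements of infinite order, for all [Gam] in dimension [m] and all
    signatures [(p, q)] with [p + q = m]. *)
Definition order_bound (R : realType) (m b : nat) : Prop :=
  forall p q : nat, (p + q = m)%N ->
  forall Gam : christoffel R m, W p q Gam ->
  (forall T, Gplus Gam T -> ~ infinite_order T) ->
  forall T, Gplus Gam T -> exists2 n : nat, has_order T n & (n <= b)%N.

(* Main.v *)
Require Import Defs.
From HB Require Import structures.
From mathcomp Require Import all_boot all_order all_algebra.
From mathcomp Require Import all_classical all_reals all_analysis.
From mathcomp Require Import perm separable cyclotomic.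
From mathcomp Require Import ring lra zify.
From mathcomp.real_closed Require Import mxtens complex.

(** The action of T on Gamma is an intertwining condition T mu = mu (T (x) T)
    on the matrix mu of structure constants of the product defined by Gamma;
    its infinitesimal version is A mu = mu (A (x) 1 + 1 (x) A), i.e. A is a
    derivation of this product.

    (1) The matrix exponential is a local homeomorphism at 0, and for small A,
    exp A is an automorphism if and only if A is a derivation; hence the group
    is a manifold modelled on the space of derivations. If Gamma has no
    nonzero derivation, then the defect A mu - mu (A (x) 1 + 1 (x) A) controls A
    linearly, and this survives small perturbations of Gamma. As the defect of
    T - 1 is quadratic in T - 1 when T is an automorphism, the identity is then
    isolated in the groups of all Gamma' close to Gamma.

    (2) An automorphism T of finite order is diagonalizable over R[i] with
    eigenvalues l_1, ..., l_m. Consider the relations l_a l_b = l_c and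
    l_a l_b = 1 that hold among them, as the rows of an integer matrix. If this
    matrix has an integral kernel vector v, then replacing l_a by w^(v_a), where
    w = (3 + 4i)/5 has infinite order on the unit circle, gives a real
    automorphism of infinite order. Otherwise the matrix has a left inverse up to
    an integer factor d, so l_a^d = 1 and T^d = 1; there are finitely many
    matrices, hence finitely many d, in each dimension.

    The bounds are unbounded because of the product
    x * y = x y + (3/m) s(y) x on R^m, where x y is the componentwise product
    and s(y) is the sum of the coordinates of y: its automorphisms are 0/1
    matrices, and they include the square of the cyclic shift. *)

Set Implicit Arguments.
Unset Strict Implicit.
Unset Printing Implicit Defensive.

Import Order.TTheory GRing.Theory Num.Theory.
Import numFieldNormedType.Exports.

Local Open Scope classical_set_scope.
Local Open Scope ring_scope.

(** * Matrix norm, Kronecker product and matrix exponential *)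

Section MatrixNorm.
Context {R : realType}.

Lemma ler_mx_norm m n (A : 'M[R]_(m, n)) i j : `|A i j| <= `|A|.
Proof.
rewrite [leRHS]/Num.Def.normr /= mx_normrE; exact: (le_bigmax _ _ (i, j)).
Qed.

Lemma mx_norm_le m n (A : 'M[R]_(m, n)) c :
  0 <= c -> (forall i j, `|A i j| <= c) -> `|A| <= c.
Proof.
move=> c0 Ac; rewrite [leLHS]/Num.Def.normr /= mx_normrE.
by apply/bigmax_leP; split => // -[i j] _; exact: Ac.
Qed.

(** The norm is the largest absolute value of an entry, so a product costs a factor equal to the
    inner dimension. The dimension factors in the later estimates come from here. *)
Lemma mx_norm_mul m n p (A : 'M[R]_(m, n)) (B : 'M[R]_(n, p)) :
  `|A *m B| <= n%:R * `|A| * `|B|.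
Proof.
apply: mx_norm_le => [|i j]; first by rewrite !mulr_ge0.
rewrite mxE (le_trans (ler_norm_sum _ _ _)) // -mulrA mulr_natl.
apply: (@le_trans _ _ (\sum_(k < n) `|A| * `|B|)).
  by apply: ler_sum => k _; rewrite normrM ler_pM // ler_mx_norm.
by rewrite sumr_const card_ord.
Qed.

Lemma mx_norm1 n : `|1%:M : 'M[R]_n| <= 1.
Proof.
apply: mx_norm_le => // i j; rewrite mxE.
by case: eqP => _; rewrite ?normr1 ?normr0.
Qed.

Lemma mx_norm_exp n (A : 'M[R]_n) c k : n%:R * `|A| <= c -> `|A ^+ k| <= c ^+ k.
Proof.
move=> Ac; elim: k => [|k IH]; first by rewrite !expr0 mx_norm1.
by rewrite !exprS (le_trans (mx_norm_mul _ _)) // ler_pM.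
Qed.

Lemma mx_norm_mxvec m n (A : 'M[R]_(m, n)) : `|mxvec A| = `|A|.
Proof.
apply/eqP; rewrite eq_le; apply/andP; split; apply: mx_norm_le => // i k.
  by case/mxvec_indexP: k => j l; rewrite ord1 mxvecE ler_mx_norm.
by rewrite -mxvecE ler_mx_norm.
Qed.

Lemma lipschitz_continuous m n p q (f : 'M[R]_(m, n) -> 'M[R]_(p, q)) C x :
  (\forall y \near x, `|f x - f y| <= C * `|x - y|) -> {for x, continuous f}.
Proof.
move=> fC; apply/(@cvgrPdist_lt _ _ _ (nbhs x) (nbhs_filter x)) => e e0.
near=> y.
have C1 : 0 < `|C| + 1 by rewrite ltr_wpDl.
have : `|f x - f y| <= C * `|x - y| by near: y.
move/le_lt_trans; apply.
apply: (@le_lt_trans _ _ ((`|C| + 1) * `|x - y|)).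
  by rewrite ler_wpM2r // (le_trans (ler_norm C)) // lerDl.
rewrite mulrC -ltr_pdivlMr //.
near: y; apply/nbhs_ballP; exists (e / (`|C| + 1)); first exact: divr_gt0.
by move=> y; rewrite -ball_normE.
Unshelve. all: by end_near. Qed.

Lemma global_lipschitz_continuous m n p q (f : 'M[R]_(m, n) -> 'M[R]_(p, q)) C :
  (forall x y, `|f x - f y| <= C * `|x - y|) -> continuous f.
Proof.
move=> fC x; apply: (lipschitz_continuous (C := C)).
exact: (@filterE _ (nbhs x) (nbhs_filter x)).
Qed.

End MatrixNorm.

(** * Bilinearity and powers of Kronecker products *)

Section Tensor.
Variable K : comPzRingType.
Implicit Types m n p q : nat.

Lemma tensmxDl m n p q (A B : 'M[K]_(m, n)) (C : 'M[K]_(p, q)) :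
  (A + B) *t C = A *t C + B *t C.
Proof. by apply/matrixP => i j; rewrite !mxE mulrDl. Qed.

Lemma tensmxDr m n p q (A B : 'M[K]_(m, n)) (C : 'M[K]_(p, q)) :
  C *t (A + B) = C *t A + C *t B.
Proof. by apply/matrixP => i j; rewrite !mxE mulrDr. Qed.

Lemma tensmxZl m n p q a (A : 'M[K]_(m, n)) (C : 'M[K]_(p, q)) :
  (a *: A) *t C = a *: (A *t C).
Proof. by apply/matrixP => i j; rewrite !mxE mulrA. Qed.

Lemma tensmxZr m n p q a (A : 'M[K]_(m, n)) (C : 'M[K]_(p, q)) :
  C *t (a *: A) = a *: (C *t A).
Proof. by apply/matrixP => i j; rewrite !mxE mulrCA. Qed.

Lemma tensmx11 m n : (1%:M *t 1%:M : 'M[K]_(m * n)) = 1%:M.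
Proof.
apply/matrixP => k l; case: (mxtens_indexP k) => i j; case: (mxtens_indexP l) => i' j'.
rewrite tensmxE !mxE (can_eq (@mxtens_indexK _ _)) xpair_eqE.
by do 2!case: eqP => //= _; rewrite ?mulr0 ?mul0r ?mulr1.
Qed.

Lemma tensmx_expl m n (A : 'M[K]_m) k :
  (A *t (1%:M : 'M[K]_n)) ^+ k = A ^+ k *t 1%:M.
Proof.
elim: k => [|k IH]; first by rewrite !expr0 tensmx11.
by rewrite !exprS IH [LHS]tensmx_mul mulmx1.
Qed.

Lemma tensmx_expr m n (A : 'M[K]_m) k :
  ((1%:M : 'M[K]_n) *t A) ^+ k = 1%:M *t A ^+ k.
Proof.
elim: k => [|k IH]; first by rewrite !expr0 tensmx11.
by rewrite !exprS IH [LHS]tensmx_mul mulmx1.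
Qed.

End Tensor.

(** * The matrix exponential and intertwining relations *)

Section MatrixExp.
Context {R : realType}.

Definition expmx_part n (A : 'M[R]_n) N : 'M[R]_n :=
  \sum_(0 <= k < N) k`!%:R^-1 *: A ^+ k.

Definition expmx n (A : 'M[R]_n) : 'M[R]_n :=
  \matrix_(i, j) limn (fun N => expmx_part A N i j).

Lemma expmx_cvg n (A : 'M[R]_n) i j :
  (fun N => expmx_part A N i j) @ \oo --> expmx A i j.
Proof.
rewrite mxE.
have -> : (fun N => expmx_part A N i j) =
    series (fun k => k`!%:R^-1 * (A ^+ k) i j).
  by apply/funext => N; rewrite /expmx_part summxE; apply: eq_bigr => k _; rewrite mxE.
apply: normed_cvg.
(* The series is dominated by the real exponential series at n times the norm of [A]. *)
apply: (@series_le_cvg _ _ (exp_coeff (n%:R * `|A|))) => [k|k|k|].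
- exact: normr_ge0.
- by rewrite exp_coeff_ge0 // mulr_ge0.
  rewrite /= normrM (@ger0_norm _ _^-1) ?invr_ge0 ?ler0n // [leLHS]mulrC /exp_coeff /=.
  rewrite ler_wpM2r ?invr_ge0 ?ler0n //.
  by rewrite (le_trans (ler_mx_norm _ _ _)) // mx_norm_exp.
- exact: is_cvg_series_exp_coeff.
Qed.

Lemma expmx_eq n (A B : 'M[R]_n) :
  (forall i j, (fun N => expmx_part A N i j) @ \oo --> B i j) -> expmx A = B.
Proof.
move=> AB; apply/matrixP => i j.
exact: (cvg_unique _ (@expmx_cvg n A i j) (AB i j)).
Qed.

Lemma cvg_mulmx_entry m n p (F : nat -> 'M[R]_(m, n)) (G : nat -> 'M[R]_(n, p))
    (A : 'M[R]_(m, n)) (B : 'M[R]_(n, p)) :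
  (forall i j, F N i j @[N --> \oo] --> A i j) ->
  (forall i j, G N i j @[N --> \oo] --> B i j) ->
  forall i j, (F N *m G N) i j @[N --> \oo] --> (A *m B) i j.
Proof.
move=> FA GB i j; rewrite mxE.
under eq_fun do rewrite mxE.
by apply: cvg_big => [|k _]; [exact: add_continuous | exact: cvgM].
Qed.

Lemma expmx0 n : expmx (0 : 'M[R]_n) = 1%:M.
Proof.
apply: expmx_eq => i j; apply: cvg_near_cst.
near=> N; rewrite /expmx_part.
have N0 : (0 < N)%N by near: N; exists 1%N.
rewrite big_ltn // big_nat big1 ?addr0 => [|k /andP[k0 _]].
  by rewrite fact0 invr1 scale1r.
by rewrite expr0n eqn0Ngt k0 scaler0.
Unshelve. all: by end_near. Qed.

(** The relation passes to powers, then to partial sums, then to the limit. *)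
Lemma expmx_intertwine m n (A : 'M[R]_m) (B : 'M[R]_n) (M : 'M[R]_(m, n)) :
  A *m M = M *m B -> expmx A *m M = M *m expmx B.
Proof.
move=> AM.
have AMk k : A ^+ k *m M = M *m B ^+ k.
  elim: k => [|k IH]; first by rewrite !expr0 mul1mx mulmx1.
  by rewrite exprS -mulmxA IH mulmxA AM -mulmxA exprS.
have AMN N : expmx_part A N *m M = M *m expmx_part B N.
  rewrite mulmx_suml mulmx_sumr; apply: eq_bigr => k _.
  by rewrite -scalemxAl -scalemxAr AMk.
apply/matrixP => i j.
have cstM k l : M k l @[_ --> \oo] --> M k l by exact: cvg_cst.
have c1 : (expmx_part A N *m M) i j @[N --> \oo] --> (expmx A *m M) i j.
  by apply: (@cvg_mulmx_entry _ _ _ (expmx_part A) (fun=> M)) => // *; exact: expmx_cvg.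
have c2 : (expmx_part A N *m M) i j @[N --> \oo] --> (M *m expmx B) i j.
  under eq_fun do rewrite AMN.
  by apply: (@cvg_mulmx_entry _ _ _ (fun=> M)) => // *; exact: expmx_cvg.
exact: (cvg_unique _ c1 c2).
Qed.

(** The sum is at most exp c - 1, and exp c <= 1 / (1 - c) <= 1 + 2c for 0 <= c <= 1/2. *)
Lemma exp_partial_bound (c : R) N : 0 <= c -> c <= 2^-1 ->
  \sum_(0 <= k < N) c ^+ k.+1 / (k.+1)`!%:R <= 2 * c.
Proof.
move=> c0 c1.
suff : 1 + \sum_(0 <= k < N) c ^+ k.+1 / (k.+1)`!%:R <= 1 + 2 * c by rewrite lerD2l.
have -> : 1 + \sum_(0 <= k < N) c ^+ k.+1 / (k.+1)`!%:R = series (exp_coeff c) N.+1.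
  by rewrite /series /= big_nat_recl // /exp_coeff /= expr0 fact0 divr1.
have : series (exp_coeff c) N.+1 <= expR c.
  apply: nondecreasing_cvgn_le; last exact: is_cvg_series_exp_coeff.
  by apply/nondecreasing_seqP => k; rewrite seriesSr lerDl exp_coeff_ge0.
move/le_trans; apply.
have h := expR_ge1Dx (- c).
have e0 := expR_gt0 c.
have h2 : expR c * expR (- c) = 1 by rewrite -expRD subrr expR0.
have : expR c * (1 - c) <= 1 by rewrite -[leRHS]h2 (ler_wpM2l (ltW e0)).
nra.
Qed.

(** The first-order part of exp(A) M - M exp(B) is Z = AM - MB. By D_(k+1) = A D_k + Z B^k every
    higher term is also controlled by Z, so the remainder is small relative to Z itself. This one
    estimate yields both the local invertibility of the exponential and the passage from
    automorphisms to derivations. *)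
Lemma expmx_intertwine_bound m n (A : 'M[R]_m) (B : 'M[R]_n) (M : 'M[R]_(m, n)) c :
  m%:R * `|A| <= c -> n%:R * `|B| <= c -> c <= 2^-1 ->
  `|expmx A *m M - M *m expmx B - (A *m M - M *m B)|
    <= 2 * n%:R * c * `|A *m M - M *m B|.
Proof.
move=> Ac Bc c1; set Z := A *m M - M *m B.
have c0 : 0 <= c by rewrite (le_trans _ Ac) // mulr_ge0.
pose D k := A ^+ k *m M - M *m B ^+ k.
have DS k : D k.+1 = A *m D k + Z *m B ^+ k.
  by rewrite /D mulmxBr /Z mulmxBl !exprS -!mulmxE !mulmxA addrA subrK.
have Bk k : `|B ^+ k| <= c ^+ k by exact: mx_norm_exp.
have Dk k : `|D k.+1| <= (k.+1)%:R * (n%:R * `|Z|) * c ^+ k.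
  elim: k => [|k IH].
    rewrite /D !expr1 expr0 mulr1 mul1r -/Z.
    (* For n = 0 the factor [n%:R] vanishes, but then [Z] has no columns. *)
    case: n B M Bc @Z @D DS Bk => [|n'] B M Bc Z D DS Bk.
      by rewrite [Z]thinmx0 normr0 mul0r.
    by rewrite ler_peMl // ler1n.
  rewrite DS (le_trans (ler_normD _ _)) //.
  rewrite -[k.+2]addn1 natrD mulrDl mulrDl mul1r.
  have -> : k.+1%:R * (n%:R * `|Z|) * c ^+ k.+1 =
    c * (k.+1%:R * (n%:R * `|Z|) * c ^+ k) by rewrite exprS mulrCA.
  apply: lerD.
    by rewrite (le_trans (mx_norm_mul _ _)) // ler_pM // mulr_ge0.
  by rewrite (le_trans (mx_norm_mul _ _)) // ler_pM // mulr_ge0.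
(* The terms of order 0 and 1 contribute 0 and [Z], so the remainder starts at order 2. *)
have part N : expmx_part A N.+2 *m M - M *m expmx_part B N.+2 - Z =
    \sum_(0 <= k < N) (k.+2)`!%:R^-1 *: D k.+2.
  rewrite mulmx_suml mulmx_sumr -sumrB.
  under eq_bigr do rewrite -scalemxAl -scalemxAr -scalerBr -/(D _).
  rewrite big_nat_recl // big_nat_recl //= {1 2}/D !fact0 !invr1 !scale1r !expr0 !expr1.
  by rewrite mul1mx mulmx1 subrr add0r -/Z addrC addKr.
have partN N : `|expmx_part A N.+2 *m M - M *m expmx_part B N.+2 - Z| <=
    2 * n%:R * c * `|Z|.
  rewrite part (le_trans (ler_norm_sum _ _ _)) //.
  apply: (@le_trans _ _ (n%:R * `|Z| * \sum_(0 <= k < N) c ^+ k.+1 / (k.+1)`!%:R)).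
    rewrite mulr_sumr ler_sum // => k _; rewrite normrZ.
    rewrite ger0_norm ?invr_ge0 // mulrC ler_pdivrMr ?ltr0n ?fact_gt0 //.
    rewrite (le_trans (Dk _)) // (factS k.+1) natrM.
    have f0 : (k.+1)`!%:R != 0 :> R by rewrite pnatr_eq0 -lt0n fact_gt0.
    by rewrite le_eqVlt; apply/orP; left; apply/eqP; field.
  rewrite (_ : 2 * n%:R * c * `|Z| = n%:R * `|Z| * (2 * c)); last by ring.
  by rewrite ler_wpM2l ?mulr_ge0 // exp_partial_bound.
apply: mx_norm_le => [|i j]; first by rewrite !mulr_ge0.
have cv : (expmx_part A N.+2 *m M - M *m expmx_part B N.+2 - Z) i j @[N --> \oo]
    --> (expmx A *m M - M *m expmx B - Z) i j.
  have shiftA n0 (X : 'M[R]_n0) k l :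
      expmx_part X N.+2 k l @[N --> \oo] --> expmx X k l.
    rewrite (cvg_shiftS (fun N => expmx_part X N.+1 k l)).
    rewrite (cvg_shiftS (fun N => expmx_part X N k l)); exact: expmx_cvg.
  have cstM k l : M k l @[_ --> \oo] --> M k l by exact: cvg_cst.
  have cA : (expmx_part A N.+2 *m M) i j @[N --> \oo] --> (expmx A *m M) i j.
    by apply: (@cvg_mulmx_entry _ _ _ (fun N => expmx_part A N.+2) (fun=> M)).
  have cB : (M *m expmx_part B N.+2) i j @[N --> \oo] --> (M *m expmx B) i j.
    by apply: (@cvg_mulmx_entry _ _ _ (fun=> M) (fun N => expmx_part B N.+2)).
  rewrite [X in _ --> X]mxE [X in _ --> X + _]mxE [X in _ --> _ + X]mxE
    [X in _ --> _ + X + _]mxE.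
  under eq_fun do rewrite mxE [X in X + _]mxE [X in _ + X]mxE [X in _ + X + _]mxE.
  by apply: cvgB; [apply: cvgB | exact: cvg_cst].
apply: (ler_cvg_to (cvg_norm cv) (cvg_cst _)).
by apply: nearW => N; rewrite (le_trans (ler_mx_norm _ _ _)).
Qed.

End MatrixExp.

(** * Triangular against square partial sums of a double series *)

Section CauchyProduct.
Context {R : realType}.

(** Two indices below [N] have a sum below [N.*2], and all terms are nonnegative. *)
Lemma square_le_triangle (f : nat -> nat -> R) N : (forall i j, 0 <= f i j) ->
  \sum_(0 <= i < N) \sum_(0 <= j < N) f j i <=
  \sum_(0 <= k < N.*2) \sum_(i < k.+1) f (k - i)%N i.
Proof.
move=> f0.
have -> : \sum_(0 <= k < N.*2) \sum_(i < k.+1) f (k - i)%N i =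
   \sum_(0 <= i < N.*2) \sum_(0 <= j < N.*2 - i) f j i.
  under eq_big_nat => k /andP[_ kN].
    rewrite -(big_mkord predT (fun i => f (k - i)%N i)) (big_nat_widen _ _ N.*2) //.
    over.
  rewrite (exchange_big_dep_nat predT) //=; apply: eq_bigr => i _.
  rewrite -{1}[i in RHS]add0n.
  under [RHS]eq_bigr => j _ do rewrite -{1}(addnK i j).
  rewrite -(big_addn 0 N.*2 i predT (fun k => f (k - i)%N i)) add0n.
  by rewrite [RHS](big_nat_widenl _ 0).
have leS n1 n2 (F : nat -> R) : (n1 <= n2)%N -> (forall i, 0 <= F i) ->
    \sum_(0 <= i < n1) F i <= \sum_(0 <= i < n2) F i.
  move=> le12 F0; rewrite [leRHS](big_cat_nat (n := n1)) //= lerDl.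
  by rewrite sumr_ge0.
apply: (@le_trans _ _ (\sum_(0 <= i < N) \sum_(0 <= j < N.*2 - i) f j i)).
  by rewrite !big_nat ler_sum // => i /andP[_ iN]; apply: leS => //; lia.
by apply: leS => [|i]; [lia | exact: sumr_ge0].
Qed.

(** Both g + f and g - f are nonnegative, so the comparison of square and triangle applies to each
    of them. *)
Lemma cauchy_product_bound (f g : nat -> nat -> R) N :
  (forall i j, `|f i j| <= g i j) ->
  `|\sum_(0 <= k < N.*2) \sum_(i < k.+1) f (k - i)%N i
    - \sum_(0 <= i < N) \sum_(0 <= j < N) f j i| <=
  \sum_(0 <= k < N.*2) \sum_(i < k.+1) g (k - i)%N i
    - \sum_(0 <= i < N) \sum_(0 <= j < N) g j i.
Proof.
move=> fg.
have tri (e : R) :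
    \sum_(0 <= k < N.*2) \sum_(i < k.+1) (g (k - i)%N i + e * f (k - i)%N i) =
    \sum_(0 <= k < N.*2) \sum_(i < k.+1) g (k - i)%N i +
    e * \sum_(0 <= k < N.*2) \sum_(i < k.+1) f (k - i)%N i.
  rewrite mulr_sumr -big_split; apply: eq_bigr => k _ /=.
  by rewrite mulr_sumr -big_split.
have sqr (e : R) :
    \sum_(0 <= i < N) \sum_(0 <= j < N) (g j i + e * f j i) =
    \sum_(0 <= i < N) \sum_(0 <= j < N) g j i +
    e * \sum_(0 <= i < N) \sum_(0 <= j < N) f j i.
  rewrite mulr_sumr -big_split; apply: eq_bigr => k _ /=.
  by rewrite mulr_sumr -big_split.
have h (e : R) : `|e| = 1 -> forall i j, 0 <= g i j + e * f i j.
  move=> e1 i j; rewrite -lerBlDr sub0r; apply: le_trans (fg i j).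
  by rewrite -[`|f i j|]mul1r -e1 -normrM -normrN ler_norm.
have h1 := square_le_triangle N (h 1 (normr1 _)).
have h2 := square_le_triangle N (h (-1) (normrN1 _)).
rewrite tri sqr in h1; rewrite tri sqr in h2.
by rewrite ler_norml; apply/andP; split; lra.
Qed.

End CauchyProduct.

(** Completeness of matrix spaces is what the Banach fixed point theorem asks for in
    [expmx_surjective]. *)
HB.instance Definition _ (R : realType) m n :=
  Uniform_isComplete.Build 'M[R]_(m, n) (@cauchy_cvg 'M[R]_(m, n)).

(** * Exponentials of commuting sums, and local inversion of the exponential *)

Section MatrixExpLocal.
Context {R : realType}.

Lemma cvg_double : N.*2 @[N --> \oo] --> \oo.
Proof. by apply/cvgnyPge => M; exists M => // k /=; lia. Qed.

Lemma expmx_partD n (A B : 'M[R]_n) N : comm_mx A B ->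
  expmx_part (A + B) N = \sum_(0 <= k < N) \sum_(i < k.+1)
    ((k - i)`!%:R^-1 *: A ^+ (k - i)) *m (i`!%:R^-1 *: B ^+ i).
Proof.
move=> AB; apply: eq_bigr => k _; rewrite exprDn_comm // scaler_sumr.
apply: eq_bigr => i _; rewrite -scalemxAl -scalemxAr mulmxE -[_ *+ 'C(_, _)]scaler_nat.
rewrite [LHS]scalerA [RHS]scalerA; congr (_ *: _).
have ik : (i <= k)%N by rewrite -ltnS.
rewrite -(bin_fact ik) !natrM.
have f0 l : l`!%:R != 0 :> R by rewrite pnatr_eq0 -lt0n fact_gt0.
have b0 : 'C(k, i)%:R != 0 :> R by rewrite pnatr_eq0 -lt0n bin_gt0.
by field; rewrite !f0.
Qed.

(** The triangular minus the square partial sums are dominated by the same difference for the real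
    exponentials at [a] and [b], which tends to 0 because exp(a + b) = exp(a) exp(b). *)
Lemma expmxD n (A B : 'M[R]_n) : comm_mx A B ->
  expmx (A + B) = expmx A *m expmx B.
Proof.
move=> AB; set a := n%:R * `|A|; set b := n%:R * `|B|.
pose F i j := (i`!%:R^-1 *: A ^+ i) *m (j`!%:R^-1 *: B ^+ j).
pose g i j : R := n%:R * ((i`!%:R^-1 * a ^+ i) * (j`!%:R^-1 * b ^+ j)).
have expE (x : R) N : series (exp_coeff x) N = \sum_(0 <= k < N) k`!%:R^-1 * x ^+ k.
  by apply: eq_bigr => k _; rewrite mulrC.
have a0 : 0 <= a by rewrite mulr_ge0.
have b0 : 0 <= b by rewrite mulr_ge0.
have Fg u v i j : `|F i j u v| <= g i j.
  rewrite (le_trans (ler_mx_norm _ _ _)) // /F -scalemxAl -scalemxAr !normrZ.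
  rewrite !ger0_norm ?invr_ge0 // /g.
  rewrite [leRHS](_ : _ =
    i`!%:R^-1 * (j`!%:R^-1 * (n%:R * (a ^+ i * b ^+ j)))); last by ring.
  rewrite !ler_wpM2l ?invr_ge0 // (le_trans (mx_norm_mul _ _)) //.
  rewrite -mulrA ler_wpM2l //.
  by rewrite ler_pM // mx_norm_exp.
pose Sq (h : nat -> nat -> R) N := \sum_(0 <= i < N) \sum_(0 <= j < N) h j i.
pose Tr (h : nat -> nat -> R) N := \sum_(0 <= k < N.*2) \sum_(i < k.+1) h (k - i)%N i.
have gE N : Tr g N - Sq g N = n%:R * (series (exp_coeff (a + b)) N.*2 -
    series (exp_coeff a) N * series (exp_coeff b) N).
  rewrite mulrBr; congr (_ - _).
    rewrite expE mulr_sumr; apply: eq_bigr => k _.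
    rewrite exprDn_comm; last exact: mulrC.
    rewrite !mulr_sumr; apply: eq_bigr => i _.
    have ik : (i <= k)%N by rewrite -ltnS.
    rewrite -(bin_fact ik) !natrM -mulr_natr /g.
    have f0 l : l`!%:R != 0 :> R by rewrite pnatr_eq0 -lt0n fact_gt0.
    have C0 : 'C(k, i)%:R != 0 :> R by rewrite pnatr_eq0 -lt0n bin_gt0.
    by field; rewrite C0 !f0.
  rewrite !expE /Sq [X in _ * X]mulrC mulr_suml mulr_sumr; apply: eq_bigr => i _.
  rewrite mulr_sumr mulr_sumr; apply: eq_bigr => j _.
  by rewrite /g [X in _ * X]mulrC.
have cvE (x : R) : series (exp_coeff x) N @[N --> \oo] --> expR x.
  exact: is_cvg_series_exp_coeff.
have g0 : (Tr g N - Sq g N) @[N --> \oo] --> (0 : R).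
  under eq_fun do rewrite gE.
  have -> : 0 = n%:R * (expR (a + b) - expR a * expR b) by rewrite expRD subrr mulr0.
  apply: cvgM; first exact: cvg_cst.
  apply: cvgB; last by apply: cvgM; exact: cvE.
  exact: cvg_comp cvg_double (cvE (a + b)).
apply/matrixP => u v.
have cAB : (expmx_part A N *m expmx_part B N) u v @[N --> \oo]
    --> (expmx A *m expmx B) u v.
  by apply: (@cvg_mulmx_entry _ _ _ _ (expmx_part A) (expmx_part B)) => *;
    exact: expmx_cvg.
have SqE N : (expmx_part A N *m expmx_part B N) u v = Sq (fun i j => F i j u v) N.
  rewrite mulmx_sumr summxE; apply: eq_bigr => i _.
  by rewrite mulmx_suml summxE.
have TrE N : expmx_part (A + B) N.*2 u v = Tr (fun i j => F i j u v) N.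
  rewrite expmx_partD // summxE; apply: eq_bigr => k _.
  by rewrite summxE.
have F0 : (Tr (fun i j => F i j u v) N - Sq (fun i j => F i j u v) N) @[N --> \oo]
    --> (0 : R).
  apply: (@squeeze_cvgr _ _ _ _ (fun N => - (Tr g N - Sq g N))
    (fun N => Tr g N - Sq g N)) => //.
    by apply: nearW => N; rewrite -ler_norml cauchy_product_bound.
  by rewrite -oppr0; exact: cvgN.
(* The partial sums converge, so their limit can be read off along the even indices. *)
have dbl : expmx_part (A + B) N.*2 u v @[N --> \oo] --> (expmx A *m expmx B) u v.
  rewrite -[X in _ --> X]add0r.
  suff -> : (fun N => expmx_part (A + B) N.*2 u v) = (fun N =>
      (Tr (fun i j => F i j u v) N - Sq (fun i j => F i j u v) N) +
      (expmx_part A N *m expmx_part B N) u v) by exact: cvgD.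
  by apply/funext => N; rewrite TrE SqE subrK.
apply: cvg_unique dbl => //.
exact: cvg_comp cvg_double (@expmx_cvg _ _ (A + B) u v).
Qed.

Lemma expmx_unit n (A : 'M[R]_n) : expmx A *m expmx (- A) = 1%:M.
Proof.
rewrite -expmxD ?subrr ?expmx0 //.
by rewrite /comm_mx mulmxN mulNmx.
Qed.

(** exp(A) is the square of the invertible matrix exp(A/2). *)
Lemma det_expmx_gt0 n (A : 'M[R]_n) : 0 < \det (expmx A).
Proof.
have -> : A = 2^-1 *: A + 2^-1 *: A.
  by rewrite -scalerDl (_ : _ + _ = 1) ?scale1r //; field.
rewrite expmxD // det_mulmx -expr2 exprn_even_gt0 //=.
have := congr1 determinant (expmx_unit (2^-1 *: A)).
rewrite det_mulmx det1; case: eqP => // -> /eqP.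
by rewrite mul0r eq_sym oner_eq0.
Qed.

(** The intertwining bound at M = 1: near 0 the exponential differs from the identity map by a
    contraction. *)
Lemma expmx_lipschitz n (A B : 'M[R]_n) c :
  n%:R * `|A| <= c -> n%:R * `|B| <= c -> c <= 2^-1 -> 2 * n%:R * c <= 2^-1 ->
  `|expmx A - expmx B - (A - B)| <= 2^-1 * `|A - B|.
Proof.
move=> Ac Bc c1 nc.
have := expmx_intertwine_bound 1%:M Ac Bc c1.
rewrite !mulmx1 !mul1mx => /le_trans; apply.
by rewrite ler_wpM2r.
Qed.

Lemma expmx_bilipschitz n (A B : 'M[R]_n) c :
  n%:R * `|A| <= c -> n%:R * `|B| <= c -> c <= 2^-1 -> 2 * n%:R * c <= 2^-1 ->
  `|A - B| <= 2 * `|expmx A - expmx B| /\ `|expmx A - expmx B| <= 2 * `|A - B|.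
Proof.
move=> Ac Bc c1 nc; have := expmx_lipschitz Ac Bc c1 nc.
set E := expmx A - expmx B; set D := A - B => h.
have h1 : `|D| <= `|E| + `|E - D|.
  by rewrite -[X in `|X| <= _](subKr E) (le_trans (ler_normB _ _)).
have h2 : `|E| <= `|E - D| + `|D| by rewrite -[X in `|X| <= _](subrK D) ler_normD.
split; lra.
Qed.

(** A preimage of [S] is a fixed point of A -> S - exp(A) + A. This map is a contraction with factor
    1/2 and sends 0 to S - 1, of norm at most d/2, so it preserves the closed ball of radius [d]. *)
Lemma expmx_surjective n (S : 'M[R]_n) d :
  0 <= d -> n%:R * d <= 2^-1 -> 2 * n%:R * (n%:R * d) <= 2^-1 ->
  `|S - 1%:M| <= d / 2 -> exists2 A, `|A| <= d & expmx A = S.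
Proof.
move=> d0 d1 d2 Sd.
pose U : set 'M[R]_n := [set A | `|A| <= d].
pose h A := S - expmx A + A.
have lip A B : U A -> U B -> `|h A - h B| <= 2^-1 * `|A - B|.
  move=> UA UB.
  rewrite (_ : h A - h B = - (expmx A - expmx B - (A - B))).
    rewrite normrN; apply: expmx_lipschitz d1 d2; exact: ler_wpM2l.
  rewrite /h; move: (expmx A) (expmx B) => X Y; apply/matrixP => i j.
  rewrite !mxE; ring.
have hU : {homo h : x / U x >-> U x}.
  move=> A UA.
  have h0 : h 0 = S - 1%:M by rewrite /h expmx0 addr0.
  have U0 : U 0 by rewrite /U /= normr0.
  have := lip A 0 UA U0; rewrite subr0 h0 /U /= => hA.
  rewrite -(subrK (S - 1%:M) (h A)) (le_trans (ler_normD _ _)) //.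
  have : `|A| <= d by [].
  lra.
have clU : closed U.
  have -> : U = closed_ball_ Num.norm (0 : 'M[R]_n) d.
    by apply/seteqP; split => A; rewrite /U /closed_ball_ /= sub0r normrN.
  exact: closed_closed_ball_.
have [] := @banach_fixed_point R 'M[R]_n U (mkfun_fun hU) _ clU.
- exists (2^-1)%:nng; split => /=; first by lra.
  by move=> [A B] [UA UB] /=; exact: lip.
- by exists 0; rewrite /U /= normr0.
- move=> A UA /= hA; exists A => //.
  have /eqP : S - expmx A = 0 by rewrite -[LHS](addrK A) -/(h A) -[h A]hA subrr.
  by rewrite subr_eq0 => /eqP.
Qed.

End MatrixExpLocal.

(** * Automorphisms and derivations *)

Section StructureMatrix.
Variable K : comPzRingType.

Lemma sum_mxtens m n (F : 'I_(m * n) -> K) :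
  \sum_k F k = \sum_i \sum_j F (mxtens_index (i, j)).
Proof.
rewrite pair_bigA (reindex (@mxtens_index m n)) /=; first by apply: eq_bigr => -[].
by exists (@mxtens_unindex m n) => k _; rewrite ?mxtens_indexK ?mxtens_unindexK.
Qed.

(** The product e_i e_j = sum_c Gam_(ij)^c e_c as a linear map on the tensor square, with the pair
    (i, j) encoded as a column index. *)
Definition structure_mx m (Gam : 'I_m -> 'I_m -> 'I_m -> K) : 'M[K]_(m, m * m) :=
  \matrix_(c, k) Gam (mxtens_unindex k).1 (mxtens_unindex k).2 c.

Definition is_aut m (M : 'M[K]_(m, m * m)) (T : 'M[K]_m) :=
  T *m M = M *m (T *t T).

Lemma structure_mxE m Gam i j c :
  @structure_mx m Gam c (mxtens_index (i, j)) = Gam i j c.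
Proof. by rewrite mxE mxtens_indexK. Qed.

Lemma structure_mx_inj m : injective (@structure_mx m).
Proof.
move=> Gam Gam' e; apply/funext => i; apply/funext => j; apply/funext => c.
by rewrite -!structure_mxE e.
Qed.

Lemma is_autE m Gam T : @is_aut m (structure_mx Gam) T <->
  forall i j c, \sum_a \sum_b Gam a b c * (T a i * T b j) =
                \sum_k T c k * Gam i j k.
Proof.
have L i j c : (T *m structure_mx Gam) c (mxtens_index (i, j)) =
    \sum_k T c k * Gam i j k.
  by rewrite mxE; apply: eq_bigr => k _; rewrite structure_mxE.
have r i j c : (structure_mx Gam *m (T *t T)) c (mxtens_index (i, j)) =
    \sum_a \sum_b Gam a b c * (T a i * T b j).
  rewrite mxE sum_mxtens; apply: eq_bigr => a _; apply: eq_bigr => b _.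
  by rewrite structure_mxE tensmxE.
split=> [e i j c|e]; first by rewrite -L -r e.
apply/matrixP => c k; case: (mxtens_indexP k) => i j.
by rewrite L r e.
Qed.

Lemma is_aut1 m M : @is_aut m M 1%:M.
Proof. by rewrite /is_aut tensmx11 mul1mx mulmx1. Qed.

Lemma is_autM m M S T : @is_aut m M S -> is_aut M T -> is_aut M (S *m T).
Proof.
by rewrite /is_aut => eS eT; rewrite -mulmxA eT mulmxA eS -mulmxA tensmx_mul.
Qed.

Lemma is_autX m M T k : @is_aut m M T -> is_aut M (T ^+ k).
Proof.
move=> aT; elim: k => [|k IH]; first by rewrite expr0; exact: is_aut1.
by rewrite exprS; exact: is_autM.
Qed.

End StructureMatrix.

Lemma is_autV (K : comUnitRingType) m M T : T \in unitmx ->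
  @is_aut K m M T -> is_aut M (invmx T).
Proof.
rewrite /is_aut => uT aT.
by rewrite -[M in RHS](mulKmx uT) aT -!mulmxA tensmx_mul mulmxV // tensmx11 mulmx1.
Qed.

Section Automorphisms.
Context {R : realType} {m : nat}.
Implicit Types (Gam : christoffel R m) (T : 'M[R]_m).

(** In matrix form the action is a change of basis, so that being fixed by [T] becomes the
    intertwining condition [is_aut]. *)
Lemma structure_mx_act T Gam :
  structure_mx (act T Gam) = invmx T *m structure_mx Gam *m (T *t T).
Proof.
apply/matrixP => k l; case: (mxtens_indexP l) => i j.
rewrite structure_mxE /act /christoffel_form -!colE -rowE -mulmxA [RHS]mxE.
under [RHS]eq_bigr do rewrite mxE sum_mxtens mulr_sumr.
rewrite [RHS]exchange_big; apply: eq_bigr => a _ /=.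
under [RHS]eq_bigr do rewrite mulr_sumr.
rewrite [RHS]exchange_big; apply: eq_bigr => b _ /=.
apply: eq_bigr => c _.
rewrite structure_mxE tensmxE !mxE; ring.
Qed.

Lemma GplusE Gam T : Gplus Gam T <-> 0 < \det T /\ is_aut (structure_mx Gam) T.
Proof.
have uT : 0 < \det T -> T \in unitmx by rewrite unitmxE unitfE => /lt0r_neq0.
rewrite /Gplus /is_aut /=; split=> -[dT aT]; split => //; have {}uT := uT dT.
  by rewrite -[in LHS]aT structure_mx_act -mulmxA mulKVmx.
apply: (@structure_mx_inj _ m).
by rewrite structure_mx_act -mulmxA -aT mulKmx.
Qed.

Lemma Gplus1 Gam : Gplus Gam 1%:M.
Proof. by apply/GplusE; rewrite det1; split => //; exact: is_aut1. Qed.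

Lemma GplusM Gam S T : Gplus Gam S -> Gplus Gam T -> Gplus Gam (S *m T).
Proof.
move=> /GplusE[dS aS] /GplusE[dT aT]; apply/GplusE.
by rewrite det_mulmx mulr_gt0 //; split => //; exact: is_autM.
Qed.

Lemma GplusV Gam T : Gplus Gam T -> Gplus Gam (invmx T).
Proof.
move=> /GplusE[dT aT]; apply/GplusE; rewrite det_inv invr_gt0; split => //.
by apply: is_autV => //; rewrite unitmxE unitfE lt0r_neq0.
Qed.

Lemma GplusX Gam T k : Gplus Gam T -> Gplus Gam (T ^+ k).
Proof.
move=> GT; elim: k => [|k IH]; first by rewrite expr0; exact: Gplus1.
by rewrite exprS; exact: GplusM.
Qed.

Lemma Gplus_unit Gam T : Gplus Gam T -> T \in unitmx.
Proof. by move=> [dT _]; rewrite unitmxE unitfE lt0r_neq0. Qed.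

End Automorphisms.

(** * Derivations and their exponentials *)

Section Derivations.
Context {R : realType}.

Definition tens_der m (A : 'M[R]_m) : 'M[R]_(m * m) := A *t 1%:M + 1%:M *t A.

Definition der_defect m (M : 'M[R]_(m, m * m)) (A : 'M[R]_m) :=
  A *m M - M *m tens_der A.

Fact der_defect_linear m M : linear (@der_defect m M).
Proof.
move=> a A B; rewrite /der_defect /tens_der.
rewrite tensmxDl tensmxDr tensmxZl tensmxZr !mulmxDl !mulmxDr.
rewrite -!scalemxAl -!scalemxAr; apply/matrixP => i j.
do ![rewrite mxE | rewrite [X in _ = X + _]mxE]; ring.
Qed.
HB.instance Definition _ m M := GRing.isLinear.Build R _ _ _ (@der_defect m M)
  (der_defect_linear M).

Lemma mx_norm_tens m n p q (A : 'M[R]_(m, n)) (B : 'M[R]_(p, q)) :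
  `|A *t B| <= `|A| * `|B|.
Proof.
apply: mx_norm_le => [|k l]; first by rewrite mulr_ge0.
case: (mxtens_indexP k) => i i'; case: (mxtens_indexP l) => j j'.
by rewrite tensmxE normrM ler_pM // ler_mx_norm.
Qed.

Lemma mx_norm_tens_der m (A : 'M[R]_m) : `|tens_der A| <= 2 * `|A|.
Proof.
rewrite (le_trans (ler_normD _ _)) // [leRHS]mulr_natl mulr2n lerD //.
  by rewrite (le_trans (mx_norm_tens _ _)) // ler_piMr // mx_norm1.
by rewrite (le_trans (mx_norm_tens _ _)) // ler_piMl // mx_norm1.
Qed.

Lemma expmx_tensl m n (A : 'M[R]_m) :
  expmx (A *t (1%:M : 'M[R]_n)) = expmx A *t 1%:M.
Proof.
have partE N : expmx_part (A *t (1%:M : 'M[R]_n)) N = expmx_part A N *t 1%:M.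
  rewrite /expmx_part; elim: N => [|N IH]; first by rewrite !big_geq // tens0mx.
  by rewrite !big_nat_recr //= IH tensmxDl tensmx_expl tensmxZl.
apply: expmx_eq => k l; case: (mxtens_indexP k) => i i'; case: (mxtens_indexP l) => j j'.
under eq_fun do rewrite partE tensmxE.
by rewrite tensmxE; apply: cvgM; [exact: expmx_cvg | exact: cvg_cst].
Qed.

Lemma expmx_tensr m n (A : 'M[R]_m) :
  expmx ((1%:M : 'M[R]_n) *t A) = 1%:M *t expmx A.
Proof.
have partE N : expmx_part ((1%:M : 'M[R]_n) *t A) N = 1%:M *t expmx_part A N.
  rewrite /expmx_part; elim: N => [|N IH]; first by rewrite !big_geq // tensmx0.
  by rewrite !big_nat_recr //= IH tensmxDr tensmx_expr tensmxZr.
apply: expmx_eq => k l; case: (mxtens_indexP k) => i i'; case: (mxtens_indexP l) => j j'.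
under eq_fun do rewrite partE tensmxE.
by rewrite tensmxE; apply: cvgM; [exact: cvg_cst | exact: expmx_cvg].
Qed.

(** The two summands of [tens_der A] commute. *)
Lemma expmx_tens_der m (A : 'M[R]_m) : expmx (tens_der A) = expmx A *t expmx A.
Proof.
rewrite expmxD; last by rewrite /comm_mx !tensmx_mul !mulmx1 !mul1mx.
by rewrite expmx_tensl expmx_tensr tensmx_mul mulmx1 mul1mx.
Qed.

Lemma expmx_is_aut m M A : @der_defect m M A = 0 -> is_aut M (expmx A).
Proof.
move=> /eqP; rewrite subr_eq0 => /eqP e.
by rewrite /is_aut -expmx_tens_der; exact: expmx_intertwine.
Qed.

(** When exp(A) is an automorphism, the intertwining bound says that the defect of [A] has norm at
    most half of itself. *)
Lemma expmx_is_aut_small m M A c : (m * m)%:R * (2 * `|A|) <= c ->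
  m%:R * `|A| <= c -> c <= 2^-1 -> 2 * (m * m)%:R * c <= 2^-1 ->
  is_aut M (expmx A) -> @der_defect m M A = 0.
Proof.
move=> dAc Ac c1 c2; rewrite /is_aut -expmx_tens_der => e.
have := @expmx_intertwine_bound _ _ _ A (tens_der A) M c Ac _ c1.
rewrite e subrr sub0r normrN -/(der_defect M A) => h.
have {}h := h (le_trans (ler_wpM2l (ler0n _ _) (mx_norm_tens_der A)) dAc).
apply/eqP; rewrite -normr_le0.
have := ler_wpM2r (normr_ge0 (der_defect M A)) c2.
by lra.
Qed.

End Derivations.

(** * The group as a manifold *)

Section LieDim.
Context {R : realType} {m : nat}.
Implicit Types G : set 'M[R]_m.

(** Non-isolation of the identity replaces positive dimension in the limit argument. The next two
    lemmas translate between them without invariance of domain. *)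
Definition clusters_at_1 G := forall e : R, 0 < e ->
  exists T, [/\ G T, T <> 1%:M & `|T - 1%:M| < e].

Lemma lie_dim_clusters G : G 1%:M -> (1 <= lie_dim G)%N -> clusters_at_1 G.
Proof.
(* Both dimension 0 and the default value 0 contradict the hypothesis, so there are charts of
   dimension [d.+1]. *)
rewrite /lie_dim => G1; case: xgetP => [[//|d] _ locd _|//].
have [U [V [f [g [[oU U1] oV [_ cg] fg gf]]]]] := locd _ G1.
move=> e e0.
have [Vf gfE] := fg _ (conj G1 U1).
have cgf : g v @[v --> f 1%:M] --> g (f 1%:M).
  by move: cg; rewrite continuous_open_subspace // => cg; apply: cg; exact: mem_set.
have near1 : \forall v \near f 1%:M, V v /\ `|g v - 1%:M| < e.
  apply: filterI; first exact: open_nbhs_nbhs.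
  rewrite gfE in cgf.
  move/cvgrPdist_lt : cgf => /(_ e e0); apply: filterS => v.
  by rewrite distrC.
move/nbhs_ballP : near1 => [r /= r0 rV].
(* A chart point near the image of 1 but different from it. *)
pose v : 'rV[R]_d.+1 := f 1%:M + const_mx (r / 2).
have [|Vv gv] := rV v.
  rewrite -ball_normE /= /v opprD addrA subrr sub0r normrN.
  apply: (@le_lt_trans _ _ (r / 2)); last lra.
  by apply: mx_norm_le => [|i j]; [lra | rewrite mxE ger0_norm //; lra].
have [[GT _] fgv] := gf _ Vv.
exists (g v); split => // g1; move: fgv; rewrite g1 /v => /rowP/(_ 0).
by rewrite !mxE => /eqP; rewrite -subr_eq0 opprD addNKr oppr_eq0; lra.
Qed.

(** A chart with values in R^0 has at most one point in its domain, which would isolate the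
    identity. The existence of some dimension rules out the default value. *)
Lemma lie_dim_ge1 G : G 1%:M -> (exists d, locally_euclidean G d) ->
  clusters_at_1 G -> (1 <= lie_dim G)%N.
Proof.
rewrite /lie_dim => G1 exd acc; case: xgetP => [[|//] _ loc0|noc]; last first.
  by case: exd => d /noc.
have [U [V [f [g [[oU U1] oV _ fg gf]]]]] := loc0 _ G1.
have /nbhs_ballP[r /= r0 rU] : nbhs (1%:M : 'M[R]_m) U by exact: open_nbhs_nbhs.
have [T [GT T1 Tr]] := acc _ r0.
have UT : U T by apply: rU; rewrite -ball_normE /= distrC.
case: T1; have [_ <-] := fg T (conj GT UT); have [_ <-] := fg _ (conj G1 U1).
by congr g; rewrite [LHS]thinmx0 [RHS]thinmx0.
Qed.

End LieDim.

(** * Exponential charts modelled on the space of derivations *)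

Section Chart.
Context {R : realType} {m : nat}.
Variable Gam : christoffel R m.
Let M := structure_mx Gam.

(** The rows of [B] form a basis of the derivations; [phi] turns coordinates into a derivation, and
    [psi] recovers them through a pseudo-inverse defined on all matrices. *)
Let B := row_base (kermx (lin_mx (der_defect M))).
Let d := \rank (kermx (lin_mx (der_defect M))).
Let phi (v : 'rV[R]_d) : 'M[R]_m := vec_mx (v *m B).
Let psi (A : 'M[R]_m) : 'rV[R]_d := mxvec A *m pinvmx B.

Let phi_der v : der_defect M (phi v) = 0.
Proof.
apply: (can_inj mxvecK); rewrite -mul_rV_lin linear0; apply/sub_kermxP.
by rewrite (submx_trans (submxMl _ _)) // eq_row_base.
Qed.

Let phiK v : psi (phi v) = v.
Proof. by rewrite /psi /phi vec_mxK mulmxKp // row_base_free. Qed.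

Let psiK A : der_defect M A = 0 -> phi (psi A) = A.
Proof.
move=> A0; rewrite /psi /phi mulmxKpV ?mxvecK // eq_row_base.
by apply/sub_kermxP; rewrite mul_vec_lin /= A0 linear0.
Qed.

Let phi_lip v w : `|phi v - phi w| <= d%:R * `|B| * `|v - w|.
Proof.
rewrite /phi -linearB -mulmxBl -mx_norm_mxvec vec_mxK.
by rewrite (le_trans (mx_norm_mul _ _)) // mulrAC.
Qed.

Let psi_lip A C : `|psi A - psi C| <= (m * m)%:R * `|pinvmx B| * `|A - C|.
Proof.
rewrite /psi -mulmxBl -linearB.
by rewrite (le_trans (mx_norm_mul _ _)) // mx_norm_mxvec mulrAC.
Qed.

(** With r = 1/(8 m^4) and c = 1/(4 m^2), all smallness conditions of the exponential lemmas hold at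
    once. *)
Let small_radius : (0 < m)%N -> exists2 r : R, 0 < r &
  [/\ m%:R * r <= 2^-1, 2 * m%:R * (m%:R * r) <= 2^-1 &
      exists2 c, (m * m)%:R * (2 * r) <= c /\ m%:R * r <= c &
      c <= 2^-1 /\ 2 * (m * m)%:R * c <= 2^-1].
Proof.
move=> m0; set x : R := m%:R.
have x1 : 1 <= x by rewrite ler1n.
have x0 : x != 0 by rewrite gt_eqF // (lt_le_trans ltr01).
have xv : x^-1 <= 1 by rewrite invf_le1 // (lt_le_trans ltr01).
have xv0 : 0 <= x^-1 by rewrite invr_ge0 (le_trans ler01).
rewrite natrM -/x; set y := x^-1 in xv xv0.
have xy : x * y = 1 by rewrite mulfV.
have y2 : y ^+ 2 <= 1 by rewrite exprn_ile1.
have y3 : y ^+ 3 <= 1 by rewrite exprn_ile1.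
exists (8^-1 * y ^+ 4).
  by rewrite mulr_gt0 ?invr_gt0 // exprn_gt0 // invr_gt0 (lt_le_trans ltr01).
have e1 : x * (8^-1 * y ^+ 4) = 8^-1 * y ^+ 3 by rewrite exprS; ring: xy.
have e2 : x * (8^-1 * y ^+ 3) = 8^-1 * y ^+ 2 by rewrite exprS; ring: xy.
have e3 : x * x * (2 * (8^-1 * y ^+ 4)) = 4^-1 * y ^+ 2 by rewrite !exprS; field: xy.
split.
- by rewrite e1; lra.
- by rewrite e1 -mulrA e2; lra.
- exists (4^-1 * y ^+ 2); split; rewrite ?e3 ?e1 //; try lra.
    rewrite exprS; nra.
  have -> : 2 * (x * x) * (4^-1 * y ^+ 2) = 2^-1 * (x * y) ^+ 2 by field.
  by rewrite xy expr1n mulr1.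
Qed.

(** Near [T] the group elements are T exp(A) with [A] a small derivation; the chart sends [X] to the
    coordinates of log(T^-1 X). *)
Lemma Gplus_locally_euclidean : (0 < m)%N -> locally_euclidean (Gplus Gam) d.
Proof.
move=> m0.
have [r r0 [r1 r2 [c [rc rc'] [c1 c2]]]] := small_radius m0.
have mr (A : 'M[R]_m) : `|A| < r -> m%:R * `|A| <= m%:R * r.
  by move=> /ltW Ar; rewrite ler_wpM2l.
have lip (A C : 'M[R]_m) : `|A| < r -> `|C| < r ->
    `|A - C| <= 2 * `|expmx A - expmx C| /\ `|expmx A - expmx C| <= 2 * `|A - C|.
  by move=> Ar Cr; apply: expmx_bilipschitz r1 r2; exact: mr.
have inj (A C : 'M[R]_m) : `|A| < r -> `|C| < r -> expmx A = expmx C -> A = C.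
  move=> Ar Cr e; have [h _] := lip _ _ Ar Cr.
  by apply/eqP; rewrite -subr_eq0 -normr_le0 (le_trans h) // e subrr normr0 mulr0.
(* A local logarithm; by [logP] the default value 0 never matters within distance r/4 of 1. *)
pose logm S := xget 0 [set A : 'M[R]_m | `|A| < r /\ expmx A = S].
have logP S : `|S - 1%:M| < r / 4 -> `|logm S| < r /\ expmx (logm S) = S.
  move=> Sr; rewrite /logm; case: xgetP => [A _ [Ar eA] //|].
  have [||||A Ar eA] := @expmx_surjective _ _ S (r / 2).
  - lra.
  - by apply: le_trans r1; rewrite ler_wpM2l //; lra.
  - apply: le_trans r2; rewrite ler_wpM2l ?mulr_ge0 // ler_wpM2l //; lra.
  - lra.
  - by move/(_ A); case; split => //; apply: le_lt_trans Ar _; lra.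
have logK A : `|A| < r -> logm (expmx A) = A.
  move=> Ar; rewrite /logm; case: xgetP => [C _ [Cr eC]|/(_ A) []//].
  exact: inj.
have der A : `|A| < r -> is_aut M (expmx A) -> der_defect M A = 0.
  move=> Ar; apply: expmx_is_aut_small c1 c2.
    by rewrite (le_trans _ rc) // ler_wpM2l // ler_wpM2l // ltW.
  exact: le_trans (mr _ Ar) rc'.
move=> T GT; have uT := Gplus_unit GT.
pose f X := psi (logm (invmx T *m X)).
pose g v := T *m expmx (phi v).
pose U := [set X : 'M[R]_m | `|invmx T *m X - 1%:M| < r / 4].
(* The first condition makes the exponential injective; the second puts [g v] into [U]. *)
pose V := [set v | `|phi v| < r /\ `|expmx (phi v) - 1%:M| < r / 4].
have mulT_lip (S X Y : 'M[R]_m) : `|S *m X - S *m Y| <= m%:R * `|S| * `|X - Y|.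
  by rewrite -mulmxBr mx_norm_mul.
have near_lt p q p' q' (h : 'M[R]_(p, q) -> 'M[R]_(p', q')) x e :
    {for x, continuous h} -> `|h x| < e -> \forall y \near x, `|h y| < e.
  by move=> hc hx; exact: (cvgr_norm_lt _ hc).
have cphi v : {for v, continuous phi}.
  exact: (global_lipschitz_continuous phi_lip).
have near_phi v : `|phi v| < r -> \forall w \near v, `|phi w| < r by exact: near_lt.
have cexp v : `|phi v| < r -> {for v, continuous (fun w => expmx (phi w) - 1%:M)}.
  move=> vr; apply: (@lipschitz_continuous _ _ _ _ _ _ (2 * (d%:R * `|B|))).
  move: (near_phi _ vr); apply: filterS => w wr.
  rewrite opprB addrA subrK (le_trans (lip _ _ vr wr).2) // -mulrA ler_wpM2l //.
have near_U X : U X -> \forall Y \near X, U Y.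
  apply: (near_lt _ _ _ _ (fun Y => invmx T *m Y - 1%:M)).
  apply: (@global_lipschitz_continuous _ _ _ _ _ _ (m%:R * `|invmx T|)).
  by move=> Y Z; rewrite opprB addrA subrK.
exists U, V, f, g; split.
- split; last by rewrite /U /= mulVmx // subrr normr0; lra.
  by rewrite openE => X UX; exact: near_U.
- rewrite openE => v [v1 v2]; apply: filterI; first exact: near_phi.
  exact: (near_lt _ _ _ _ (fun w => expmx (phi w) - 1%:M) _ _ (cexp _ v1)).
- split; apply: continuous_in_subspaceT => x /set_mem.
    move=> [_ Ux].
    apply: (@lipschitz_continuous _ _ _ _ _ _
      ((m * m)%:R * `|pinvmx B| * (2 * (m%:R * `|invmx T|)))).
    move: (near_U _ Ux); apply: filterS => Y UY.
    rewrite (le_trans (psi_lip _ _)) // -[leRHS]mulrA ler_wpM2l ?mulr_ge0 //.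
    have [l1 e1] := logP _ Ux; have [l2 e2] := logP _ UY.
    by rewrite (le_trans (lip _ _ l1 l2).1) // e1 e2 -mulrA ler_wpM2l.
  move=> [Vx _].
  apply: (@lipschitz_continuous _ _ _ _ _ _ (m%:R * `|T| * (2 * (d%:R * `|B|)))).
  move: (near_phi _ Vx); apply: filterS => w wr.
  rewrite (le_trans (mulT_lip _ _ _)) // -[leRHS]mulrA ler_wpM2l ?mulr_ge0 //.
  by rewrite (le_trans (lip _ _ Vx wr).2) // -mulrA ler_wpM2l.
- move=> X [GX UX]; have [l1 e1] := logP _ UX.
  have dl : der_defect M (logm (invmx T *m X)) = 0.
    by apply: der => //; rewrite e1; case/GplusE: (GplusM (GplusV GT) GX).
  by rewrite /f /g psiK // e1 mulKVmx //; split => //; split; rewrite psiK // e1.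
- move=> v [v1 v2]; split; last by rewrite /f /g mulKmx // logK // phiK.
  split; last by rewrite /U /g /= mulKmx.
  apply: GplusM => //; apply/GplusE; split; first exact: det_expmx_gt0.
  exact: expmx_is_aut (phi_der v).
Qed.

End Chart.

(** * Limits of groups of positive dimension *)

Section DerivationLimit.
Context {R : realType}.

(** An injective linear map in finite dimension has a one-sided inverse, whose norm provides the
    constant. *)
Lemma der_defect_coercive m (M : 'M[R]_(m, m * m)) :
  (forall A, der_defect M A = 0 -> A = 0) ->
  exists2 C, 0 <= C & forall A, `|A| <= C * `|der_defect M A|.
Proof.
move=> inj; have /row_freeP[K LK] : row_free (lin_mx (der_defect M)).
  apply: inj_row_free => v; rewrite mul_rV_lin => /eqP.
  rewrite mxvec_eq0 => /eqP/inj /eqP.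
  by rewrite -mxvec_eq0 vec_mxK => /eqP.
exists ((m * (m * m))%:R * `|K|); first by rewrite mulr_ge0.
move=> A; rewrite -mx_norm_mxvec -[mxvec A]mulmx1 -LK mulmxA mul_vec_lin.
by rewrite (le_trans (mx_norm_mul _ _)) // mx_norm_mxvec mulrAC.
Qed.

Lemma mx_norm_der_defect m (M : 'M[R]_(m, m * m)) A :
  `|der_defect M A| <= (m%:R + 2 * (m * m)%:R) * `|M| * `|A|.
Proof.
rewrite (le_trans (ler_normB _ _)) // -mulrA mulrDl lerD //.
  by rewrite (le_trans (mx_norm_mul _ _)) // mulrAC mulrA.
rewrite (le_trans (mx_norm_mul _ _)) //.
rewrite [leRHS](_ : _ = (m * m)%:R * `|M| * (2 * `|A|)); last by ring.
by rewrite ler_wpM2l ?mulr_ge0 // mx_norm_tens_der.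
Qed.

(** In the expansion of (1 + E) M = M ((1 + E) (x) (1 + E)), the terms linear in E form the defect
    and only the quadratic one remains. *)
Lemma is_aut_der_defect m (M : 'M[R]_(m, m * m)) E :
  is_aut M (1%:M + E) -> der_defect M E = M *m (E *t E).
Proof.
rewrite /is_aut tensmxDl !tensmxDr tensmx11 mulmxDl mul1mx !mulmxDr mulmx1 => e.
rewrite /der_defect /tens_der mulmxDr; move: e.
rewrite -!addrA => /addrI ->; rewrite addrCA !addrA; apply/matrixP => i j.
by rewrite !mxE; ring.
Qed.

Lemma der_defectB m (M N : 'M[R]_(m, m * m)) A :
  der_defect M A = der_defect N A - der_defect (N - M) A.
Proof.
rewrite /der_defect mulmxBr mulmxBl.
by rewrite opprB opprB; apply/matrixP => i j; do ![rewrite mxE]; ring.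
Qed.

(** For E = T - 1, coercivity at [M] bounds E by a quadratic term in E plus the defect of N - M at
    E. Both are small multiples of the norm of E, which forces E = 0, with one radius for all [N]
    near [M]. *)
Lemma aut_isolated_near m (M : 'M[R]_(m, m * m)) :
  (forall A, der_defect M A = 0 -> A = 0) ->
  exists2 e : R, 0 < e & forall N T, `|N - M| < e -> is_aut N T ->
    `|T - 1%:M| < e -> T = 1%:M.
Proof.
move=> /der_defect_coercive[C C0 hC].
set c1 : R := m%:R + 2 * (m * m)%:R.
have c10 : 0 <= c1 by rewrite addr_ge0 // mulr_ge0.
set c2 : R := (m * m)%:R * (`|M| + 1).
have c20 : 0 <= c2 by rewrite mulr_ge0 // addr_ge0.
(* With e = 1/(2D), the final factor C (c1 + c2) e equals 1/2 - e, which is below 1; the summand 1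
   in [D] also gives e <= 1. *)
set D := 1 + C * c1 + C * c2.
have D1 : 1 <= D by rewrite /D -addrA lerDl addr_ge0 // mulr_ge0.
have D0 : 0 < D by rewrite (lt_le_trans ltr01).
exists (D^-1 / 2); first by rewrite divr_gt0 // invr_gt0.
set e := D^-1 / 2; have eD : e * D = 2^-1 by rewrite /e mulrAC mulVf ?mul1r // gt_eqF.
have e1 : e <= 1.
  have : D^-1 <= 1 by rewrite invf_le1.
  by rewrite /e; lra.
move=> N T NM aT Te; set E := T - 1%:M in Te.
have TE : T = 1%:M + E by rewrite addrC subrK.
suff /eqP : E = 0 by rewrite subr_eq0 => /eqP.
apply/eqP; rewrite -normr_le0 leNgt; apply/negP => E0.
have := hC E; rewrite (der_defectB M N) (@is_aut_der_defect _ N E) -?TE // => h.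
have hN : `|N| <= `|M| + 1.
  rewrite -[N](subrK M) addrC (le_trans (ler_normD _ _)) // lerD2l.
  by rewrite (le_trans (ltW NM)).
have h1 : `|N *m (E *t E)| <= c2 * `|E| * `|E|.
  rewrite (le_trans (mx_norm_mul _ _)) // /c2 -!mulrA ler_wpM2l // ler_pM //.
  exact: mx_norm_tens.
have h2 := mx_norm_der_defect (N - M) E.
have h3 : `|N *m (E *t E) - der_defect (N - M) E| <= (c2 * e + c1 * e) * `|E|.
  rewrite (le_trans (ler_normB _ _)) // mulrDl lerD //.
    by rewrite (le_trans h1) // ler_wpM2r // ler_wpM2l // ltW.
  by rewrite (le_trans h2) // ler_wpM2r // ler_wpM2l // ltW.
have h4 : `|E| <= C * ((c2 * e + c1 * e) * `|E|) by rewrite (le_trans h) // ler_wpM2l.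
have h5 : C * ((c2 * e + c1 * e) * `|E|) = (2^-1 - e) * `|E|.
  by rewrite -eD /D; ring.
have e0 : 0 < e by rewrite divr_gt0 // invr_gt0.
rewrite h5 in h4; nra.
Qed.

(** Otherwise the uniform isolation radius at [Gam] would apply to the groups of all late
    [Gam_ n]. *)
Lemma clustering_derivation m (Gam_ : nat -> christoffel R m) (Gam : christoffel R m) :
  (forall i j k, Gam_ n i j k @[n --> \oo] --> Gam i j k) ->
  (forall n, clusters_at_1 (Gplus (Gam_ n))) ->
  exists2 A, der_defect (structure_mx Gam) A = 0 & A <> 0.
Proof.
move=> cvG acc; apply: contrapT => noA.
have [A A0|e e0 he] := @aut_isolated_near _ (structure_mx Gam).
  by apply: contrapT => An0; apply: noA; exists A.
have : \forall n \near \oo, forall ijk : 'I_m * 'I_m * 'I_m,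
    `|Gam_ n ijk.1.1 ijk.1.2 ijk.2 - Gam ijk.1.1 ijk.1.2 ijk.2| < e / 2.
  apply: filter_forall => -[[i j] k] /=.
  have /cvgrPdist_lt/(_ (e / 2)) := cvG i j k.
  by move/(_ (divr_gt0 e0 (ltr0n _ 2))); apply: filterS => n; rewrite distrC.
case=> n _ /(_ n (leqnn n)) hn.
have [T [GT T1 Te]] := acc n e e0.
have [_ aT] := (GplusE _ _).1 GT; apply: T1; apply: he aT Te.
apply: (@le_lt_trans _ _ (e / 2)); last lra.
apply: mx_norm_le => [|c k]; first lra.
case: (mxtens_indexP k) => i j.
by rewrite mxE [X in _ + X]mxE !structure_mxE ltW ?(hn (i, j, c)).
Qed.

(** The elements exp(tA) approach 1 as t tends to 0, and the lower Lipschitz bound keeps them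
    different from 1. *)
Lemma derivation_clusters_at_1 m (Gam : christoffel R m) A :
  der_defect (structure_mx Gam) A = 0 -> A <> 0 -> clusters_at_1 (Gplus Gam).
Proof.
move=> A0 An0 e e0.
have a0 : 0 < `|A| by rewrite normr_gt0; exact/eqP.
have m0 : (0 < m)%N.
  by case: m Gam A A0 An0 a0 => // ? ? _ n _; case: n; exact: flatmx0.
set x : R := m%:R; have x1 : 1 <= x by rewrite ler1n.
have x0 : 0 < x by rewrite (lt_le_trans ltr01).
pose c := Num.min (8^-1 / x) (e / 4).
have c0 : 0 < c by rewrite lt_min !divr_gt0 // invr_gt0.
have cx : x * c <= 8^-1.
  have : c <= 8^-1 / x by rewrite ge_min lexx.
  by rewrite ler_pdivlMr // mulrC.
have ce : c <= e / 4 by rewrite ge_min lexx orbT.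
have c1 : c <= x * c by rewrite ler_peMl // ltW.
pose t := c / x / `|A|.
have t0 : 0 < t by rewrite !divr_gt0.
have tA : `|t *: A| = c / x by rewrite normrZ gtr0_norm // /t divfK // gt_eqF.
have tAc : x * `|t *: A| <= c by rewrite tA mulrCA mulfV ?mulr1 // gt_eqF.
have tAc' : `|t *: A| <= c by rewrite (le_trans _ tAc) // ler_peMl.
have z0 : m%:R * `|0 : 'M[R]_m| <= c by rewrite normr0 mulr0 ltW.
have c2 : c <= 2^-1 by lra.
have c3 : 2 * m%:R * c <= 2^-1 by rewrite -mulrA -/x; lra.
have [h1 h2] := expmx_bilipschitz tAc z0 c2 c3.
rewrite expmx0 subr0 in h1 h2.
exists (expmx (t *: A)); split.
- apply/GplusE; split; first exact: det_expmx_gt0.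
  by apply: expmx_is_aut; rewrite linearZ /= A0 scaler0.
- move=> h; move: h1; rewrite h subrr normr0 mulr0 tA; apply/negP.
  by rewrite -ltNge divr_gt0.
- by rewrite (le_lt_trans h2) //; lra.
Qed.

Theorem lie_dim_limit m (Gam_ : nat -> christoffel R m) (Gam : christoffel R m) :
  (forall i j k, Gam_ n i j k @[n --> \oo] --> Gam i j k) ->
  (forall n, (1 <= lie_dim (Gplus (Gam_ n)))%N) ->
  (1 <= lie_dim (Gplus Gam))%N.
Proof.
move=> cvG dimG.
have [n|A A0 An0] := clustering_derivation cvG.
  exact: lie_dim_clusters (Gplus1 _) (dimG n).
apply: lie_dim_ge1; first exact: Gplus1.
  eexists; apply: Gplus_locally_euclidean.
  by case: m Gam_ Gam A {cvG dimG} A0 An0 => // ? ? ? _; case; exact: flatmx0.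
exact: derivation_clusters_at_1 A0 An0.
Qed.

End DerivationLimit.

(** * Multiplicative relations between eigenvalues *)

Section IntegerRelations.

(** The common denominator is the product of the denominators of all entries. *)
Lemma int_mx_scale p q (B : 'M[rat]_(p, q)) :
  exists2 d : nat, (0 < d)%N & exists N : 'M[int]_(p, q),
    map_mx intr N = d%:R *: B.
Proof.
pose D := (\prod_(ij : 'I_p * 'I_q) `|denq (B ij.1 ij.2)|)%N.
exists D; first by apply: prodn_gt0 => ij; rewrite absz_gt0.
exists (\matrix_(i, j) (numq (B i j) *
  (\prod_(ij | ij != (i, j)) `|denq (B ij.1 ij.2)|)%N%:Z)).
apply/matrixP => i j; rewrite !mxE intrM numqE /D [in RHS](bigD1 (i, j)) //= natrM.
rewrite -{1}absz_denq -!pmulrn; ring.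
Qed.

(** Over the rationals, either the columns are dependent or there is a left inverse; clearing
    denominators makes each alternative integral. *)
Lemma int_mx_kernel_or_inverse k m (M : 'M[int]_(k, m)) :
  (exists2 v : 'cV[int]_m, v != 0 & M *m v = 0) \/
  (exists2 d : nat, (0 < d)%N & exists N : 'M[int]_(m, k), N *m M = (d%:Z)%:M).
Proof.
pose MQ : 'M[rat]_(k, m) := map_mx intr M.
have injQ p q : injective (map_mx intr : 'M[int]_(p, q) -> 'M[rat]_(p, q)).
  move=> A B /matrixP e; apply/matrixP => i j; apply: (@intr_inj rat).
  by have := e i j; rewrite !mxE.
have [/row_fullP[B BM]|] := boolP (row_full MQ).
  right; have [d d0 [N NB]] := int_mx_scale B; exists d => //; exists N.
  apply: injQ; rewrite map_mxM /= NB -scalemxAl BM map_scalar_mx /=.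
  by rewrite scalemx1.
rewrite /row_full -mxrank_tr -/(row_free _) => nf; left.
have /rowV0Pn[u /sub_kermxP uM u0] : kermx MQ^T != 0 by rewrite kermx_eq0.
have [d d0 [v vu]] := int_mx_scale u^T.
exists v.
  apply: contra u0 => /eqP v0; move: vu; rewrite v0 map_mx0 => /eqP.
  rewrite eq_sym scaler_eq0 pnatr_eq0 eqn0Ngt d0 /= => /eqP u0.
  by rewrite -[u]trmxK u0 trmx0.
apply: injQ; rewrite map_mxM /= vu -scalemxAr map_mx0.
by rewrite -[_ *m _]trmxK trmx_mul trmxK uM trmx0 scaler0.
Qed.

Variable F : fieldType.

Lemma prod_exprz (I : Type) (r : seq I) (x : F) (e : I -> int) : x != 0 ->
  \prod_(i <- r) x ^ e i = x ^ (\sum_(i <- r) e i).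
Proof. by move=> x0; elim/big_rec2: _ => [|i y z _ ->]; rewrite ?expr0z ?expfzDr. Qed.

Lemma exprz_prod (I : Type) (r : seq I) (x : I -> F) (k : int) :
  (\prod_(i <- r) x i) ^ k = \prod_(i <- r) x i ^ k.
Proof. by elim/big_rec2: _ => [|i y z _ <-]; rewrite ?exp1rz ?expfzMl. Qed.

(** Combining the relations with the exponents in row i of [N] leaves l_i^d = 1. *)
Lemma int_mx_inverse_torsion k m (M : 'M[int]_(k, m)) (N : 'M[int]_(m, k)) d
    (l : 'I_m -> F) : N *m M = (d%:Z)%:M -> (forall i, l i != 0) ->
  (forall r, \prod_i l i ^ M r i = 1) -> forall i, l i ^+ d = 1.
Proof.
move=> NM l0 lM i.
transitivity (\prod_j l j ^ (N *m M) i j).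
  rewrite NM (bigD1 i) //= big1 => [|j ji]; last by rewrite mxE eq_sym (negbTE ji).
  by rewrite mxE eqxx mulr1.
under eq_bigr => j _ do rewrite mxE -prod_exprz //.
rewrite exchange_big big1 // => r _.
by under eq_bigr => j _ do rewrite mulrC -exprz_exp; rewrite -exprz_prod lM exp1rz.
Qed.

Lemma int_mx_kernel_relation k m (M : 'M[int]_(k, m)) (v : 'cV[int]_m) (w : F) :
  M *m v = 0 -> w != 0 -> forall r, \prod_i (w ^ v i 0) ^ M r i = 1.
Proof.
move=> Mv w0 r; under eq_bigr do rewrite exprz_exp.
have -> : \prod_i w ^ (v i 0 * M r i) = w ^ (M *m v) r 0.
  by rewrite prod_exprz // mxE; congr (_ ^ _); apply: eq_bigr => i _; rewrite mulrC.
by rewrite Mv mxE expr0z.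
Qed.

End IntegerRelations.

Section Relations.
Variable m : nat.

(* [inl (a, b, c)] stands for the relation l_a l_b = l_c, and [inr (a, b)]
   for l_a l_b = 1. *)
Definition relation := (('I_m * 'I_m * 'I_m) + ('I_m * 'I_m))%type.

Definition relation_exp (r : relation) (i : 'I_m) : int :=
  match r with
  | inl (a, b, c) => (i == a)%:Z + (i == b)%:Z - (i == c)%:Z
  | inr (a, b) => (i == a)%:Z + (i == b)%:Z
  end.

(** Relations outside [S] become zero rows, so that all these matrices have the same shape and are
    indexed by the finitely many sets [S]. *)
Definition relation_mx (S : {set relation}) : 'M[int]_(#|{: relation}|, m) :=
  \matrix_(r, i) if enum_val r \in S then relation_exp (enum_val r) i else 0.

Variable F : fieldType.
Implicit Type l : 'I_m -> F.

Definition satisfied l : {set relation} :=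
  [set r | \prod_i l i ^ relation_exp r i == 1].

Let prod_delta l a : \prod_i l i ^ (i == a)%:Z = l a.
Proof.
by rewrite (bigD1 a) //= eqxx big1 ?mulr1 ?expr1z // => i /negbTE ->.
Qed.

Lemma satisfied_mul l a b c : (forall i, l i != 0) ->
  (inl (a, b, c) \in satisfied l) = (l a * l b == l c).
Proof.
move=> l0; rewrite inE /=.
under eq_bigr do rewrite !expfzDr // -exprz_inv.
rewrite !big_split /= !(prod_delta l) (prod_delta (fun i => (l i)^-1)).
by rewrite -(inj_eq (mulIf (l0 c))) divfK // mul1r.
Qed.

Lemma satisfied_inv l a b : (forall i, l i != 0) ->
  (inr (a, b) \in satisfied l) = (l a * l b == 1).
Proof.
move=> l0; rewrite inE /=.
by under eq_bigr do rewrite expfzDr //; rewrite big_split /= !prod_delta.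
Qed.

Lemma relation_mx_satisfied l r : \prod_i l i ^ relation_mx (satisfied l) r i = 1.
Proof.
have [h|/negbTE h] := boolP (enum_val r \in satisfied l).
  by under eq_bigr do rewrite mxE h; move: h; rewrite inE => /eqP.
by rewrite big1 // => i _; rewrite mxE h expr0z.
Qed.

Lemma satisfied_relation_mx (S : {set relation}) l :
  (forall r, \prod_i l i ^ relation_mx S r i = 1) -> S \subset satisfied l.
Proof.
move=> h; apply/fintype.subsetP => r rS; rewrite inE; apply/eqP.
by rewrite -[RHS](h (enum_rank r)); apply: eq_bigr => i _; rewrite mxE enum_rankK rS.
Qed.

End Relations.

(** * Diagonalizability of matrices of finite order *)

Section Diagonalization.

(** The minimal polynomial divides X^k - 1, which is split and separable. *)
Lemma finite_order_diagonalizable (F : closedFieldType) m (T : 'M[F]_m) k :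
  k%:R != 0 :> F -> T ^+ k = 1 -> diagonalizable T.
Proof.
case: m T => [|m] T k0 Tk.
  exists 1%:M; rewrite ?unitmx1 //; apply/diagonalizable_forPex; exists 0.
  by apply/eqP; rewrite [LHS]flatmx0 [RHS]flatmx0.
apply/diagonalizableP.
have [rs rsE] := closed_field_poly_normal ('X^k - 1 : {poly F}).
have rsE' : 'X^k - 1 = \prod_(z <- rs) ('X - z%:P).
  rewrite [LHS]rsE (_ : lead_coef _ = 1) ?scale1r //.
  apply/eqP; rewrite -monicE -polyC1 monicXnsubC // lt0n.
  by apply: contraNneq k0 => ->.
exists rs.
  by rewrite -separable_prod_XsubC -rsE' separable_Xn_sub_1.
rewrite -rsE'; apply: mxminpoly_min.
by rewrite rmorphB rmorphXn /= horner_mx_X rmorph1 Tk subrr.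
Qed.

End Diagonalization.

(** * Bounding the orders *)

Section Twist.
Variable K : fieldType.

Lemma tens_diag m n (d : 'rV[K]_m) (e : 'rV[K]_n) :
  diag_mx d *t diag_mx e =
  diag_mx (\row_k (d 0 (mxtens_unindex k).1 * e 0 (mxtens_unindex k).2)).
Proof.
apply/matrixP => k l; case: (mxtens_indexP k) => i j; case: (mxtens_indexP l) => i' j'.
rewrite tensmxE !mxE mxtens_indexK (can_eq (@mxtens_indexK _ _)) xpair_eqE /=.
by do 2!case: eqP => _; rewrite /= ?mulr1n ?mulr0n ?mul0r ?mulr0.
Qed.

Lemma conj_diagX m (P : 'M[K]_m) (d : 'rV[K]_m) k : P \in unitmx ->
  (invmx P *m diag_mx d *m P) ^+ k = invmx P *m diag_mx (\row_i d 0 i ^+ k) *m P.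
Proof.
move=> uP; elim: k => [|k IH].
  rewrite expr0 (_ : diag_mx _ = 1%:M) ?mulmx1 ?mulVmx //.
  by apply/matrixP => i j; rewrite !mxE expr0.
rewrite exprS IH -mulmxE !mulmxA mulmxK // -(mulmxA (invmx P)) mulmx_diag.
by congr (_ *m diag_mx _ *m _); apply/rowP => i; rewrite !mxE exprS.
Qed.

(* In an eigenbasis the structure constant N_{ij}^c can only be nonzero when
   l_i l_j = l_c, and a diagonal matrix is an automorphism as soon as its
   entries satisfy these relations. *)
Lemma twist_is_aut m (M : 'M[K]_(m, m * m)) T P (l mu : 'rV[K]_m) :
  P \in unitmx -> P *m T = diag_mx l *m P -> is_aut M T ->
  (forall a b c, l 0 a * l 0 b = l 0 c -> mu 0 a * mu 0 b = mu 0 c) ->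
  is_aut M (invmx P *m diag_mx mu *m P).
Proof.
move=> uP PT aT rel; set Q := invmx P.
have QP : Q *m P = 1%:M by rewrite mulVmx.
have PQ : P *m Q = 1%:M by rewrite mulmxV.
have TQ : T *m Q = Q *m diag_mx l.
  by rewrite -[LHS](mulKmx uP) (mulmxA P) PT mulmxK.
set N := P *m M *m (Q *t Q).
have MN : M = Q *m N *m (P *t P).
  by rewrite /N -!mulmxA tensmx_mul QP tensmx11 mulmx1 mulmxA QP mul1mx.
have lN : diag_mx l *m N = N *m (diag_mx l *t diag_mx l).
  rewrite /N !mulmxA -PT -!mulmxA !tensmx_mul; congr (_ *m _).
  by rewrite -TQ mulmxA aT -mulmxA tensmx_mul.
have muN : diag_mx mu *m N = N *m (diag_mx mu *t diag_mx mu).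
  apply/matrixP => c k; case: (mxtens_indexP k) => i j.
  have entry (d : 'rV[K]_m) : (diag_mx d *m N) c (mxtens_index (i, j)) =
      (N *m (diag_mx d *t diag_mx d)) c (mxtens_index (i, j)) <->
      d 0 c * N c (mxtens_index (i, j)) = N c (mxtens_index (i, j)) * (d 0 i * d 0 j).
    rewrite tens_diag mul_diag_mx mul_mx_diag [X in X = _]mxE [X in _ = X]mxE.
    by rewrite [X in _ = _ * X]mxE mxtens_indexK.
  apply/entry; move/matrixP/(_ c (mxtens_index (i, j)))/entry : lN.
  have [->|N0] := eqVneq (N c (mxtens_index (i, j))) 0; first by rewrite !mulr0 !mul0r.
  by rewrite mulrC => /(mulfI N0) /esym/rel ->; rewrite mulrC.
clearbody N; rewrite /is_aut {1}MN.
rewrite !mulmxA -(mulmxA _ P Q) PQ mulmx1 -(mulmxA Q (diag_mx mu) N) muN.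
rewrite [in RHS]MN -!mulmxA !tensmx_mul; do 2!congr (_ *m _).
by rewrite (mulmxA P) PQ mul1mx.
Qed.

End Twist.

(** * A point of infinite order on the unit circle *)

Section UnitCircle.
Context {R : realType}.
Local Notation conj := (@conjc R).

Let z : R[i] := Complex 3 4.

(** Since (3 + 4i)^2 = -7 + 24i, all positive powers of 3 + 4i are congruent to it modulo 5. Their
    imaginary part is thus never 0, and none of them equals a power of 5. *)
Let z_pow n : exists a b : int, z ^+ n.+1 = Complex (5 * a + 3)%:~R (5 * b + 4)%:~R.
Proof.
elim: n => [|n [a [b IH]]]; first by exists 0, 0; rewrite expr1 /z !mulr0 !add0r.
exists (3 * a - 4 * b - 2), (4 * a + 3 * b + 4).
rewrite exprS IH /z; apply/eqP; rewrite eq_complex /=.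
by rewrite !(intrD, intrM, intrB, rmorphN) /=; apply/andP; split; apply/eqP; ring.
Qed.

Lemma unit_circle_infinite_order :
  exists w : R[i], [/\ w != 0, conj w = w^-1 & forall k : int, k != 0 -> w ^ k != 1].
Proof.
pose w := z / 5%:R.
have z0 : z != 0 by rewrite eq_complex /= negb_and pnatr_eq0.
have five0 : (5%:R : R[i]) != 0 by rewrite pnatr_eq0.
have w0 : w != 0 by rewrite mulf_neq0 ?invr_eq0.
exists w; split => //.
  apply: (mulfI w0); rewrite mulfV // /w rmorphM fmorphV rmorph_nat.
  rewrite mulrACA -invfM (_ : z * conj z = 5%:R * 5%:R) ?divff ?mulf_neq0 //.
  rewrite -natrM; apply/eqP; rewrite -(rmorph_nat (real_complex R)) eq_complex /z /=.
  by apply/andP; split; apply/eqP; ring.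
have wn n : w ^+ n.+1 != 1.
  apply/eqP => wn1; have [a [b zn]] := z_pow n.
  have : z ^+ n.+1 = 5%:R ^+ n.+1.
    by rewrite -[z](divfK five0) -/w exprMn wn1 mul1r.
  rewrite zn -natrX -(rmorph_nat (real_complex R)) => -[_ /eqP].
  rewrite intr_eq0; lia.
case=> [[|n]|n] // _; first exact: wn.
by rewrite NegzE -exprnN invr_eq1 wn.
Qed.

End UnitCircle.

(** * From finite order to a bound depending on the dimension alone *)

Section OrderBound.
Context {R : realType}.
Local Notation conj := (@conjc R).
Local Notation toC := (map_mx (real_complex R)).

Lemma conj_toC m n (A : 'M[R]_(m, n)) : map_mx conj (toC A) = toC A.
Proof. by apply/matrixP => i j; rewrite !mxE conjc_real. Qed.

Lemma conj_fixed_real m n (A : 'M[R[i]]_(m, n)) :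
  map_mx conj A = A -> exists B, A = toC B.
Proof.
move=> cA; exists (map_mx (@complex.Re R) A); apply/matrixP => i j; rewrite !mxE.
move/matrixP/(_ i j) : cA; rewrite mxE; case: (A i j) => a b [] /eqP.
by rewrite eq_sym -addr_eq0 -mulr2n mulrn_eq0 /= => /eqP ->.
Qed.

Lemma is_aut_toC m (Gam : christoffel R m) T :
  is_aut (toC (structure_mx Gam)) (toC T) <-> is_aut (structure_mx Gam) T.
Proof.
rewrite /is_aut -map_mxT -!map_mxM; split => [|->] //.
exact: map_mx_inj.
Qed.

Lemma toCX m (T : 'M[R]_m) k : toC (T ^+ k) = toC T ^+ k.
Proof.
elim: k => [|k IH]; first by rewrite !expr0 [LHS]map_mx1.
by rewrite !exprS [LHS]map_mxM IH.
Qed.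

Lemma finite_order_eigen m (T : 'M[R]_m) k : (0 < k)%N -> T ^+ k = 1 ->
  exists (P : 'M[R[i]]_m) (l : 'rV[R[i]]_m),
    [/\ P \in unitmx, P *m toC T = diag_mx l *m P & forall i, l 0 i ^+ k = 1].
Proof.
move=> k0 Tk.
have TkC : toC T ^+ k = 1.
  by rewrite -toCX Tk [LHS]map_mx1.
have [|P uP /diagonalizable_forPex[l /(simmxP uP) PT]] :=
    finite_order_diagonalizable _ TkC.
  by rewrite pnatr_eq0 -lt0n.
exists P, l; split => // i.
have TE : toC T = invmx P *m diag_mx l *m P by rewrite -mulmxA -PT mulKmx.
move: TkC; rewrite TE conj_diagX // => /(congr1 (fun X => P *m X *m invmx P)).
rewrite !mulmxA mulmxV // mul1mx mulmxK // mulmx1 mulmxV //.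
by move/matrixP/(_ i i); rewrite !mxE eqxx.
Qed.

Lemma kernel_infinite_order m (Gam : christoffel R m) T k P
    (l : 'rV[R[i]]_m) (v : 'cV[int]_m) :
  (0 < k)%N -> Gplus Gam T -> P \in unitmx -> P *m toC T = diag_mx l *m P ->
  (forall i, l 0 i ^+ k = 1) ->
  relation_mx (satisfied (fun i => l 0 i)) *m v = 0 -> v != 0 ->
  exists2 T', Gplus Gam T' & infinite_order T'.
Proof.
move=> k0 /GplusE[dT aT] uP PT lk Mv v0.
have l0 i : l 0 i != 0.
  by apply: contra_eq_neq (lk i) => ->; rewrite expr0n eqn0Ngt k0 eq_sym oner_eq0.
have lJ i : conj (l 0 i) = (l 0 i)^-1.
  apply: (mulfI (l0 i)); rewrite mulfV // -sqr_normc.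
  have : `|l 0 i| ^+ k = 1 by rewrite -normrX lk normr1.
  by move/eqP; rewrite pexpr_eq1 // => /eqP ->; rewrite expr1n.
have [w [w0 wJ wk]] := @unit_circle_infinite_order R.
pose mu : 'rV[R[i]]_m := \row_i w ^ v i 0.
have mu0 i : mu 0 i != 0 by rewrite mxE expfz_neq0.
have muJ i : conj (mu 0 i) = (mu 0 i)^-1.
  by rewrite mxE fmorphXz /= wJ exprz_inv -invr_expz.
have sub : satisfied (fun i => l 0 i) \subset satisfied (fun i => mu 0 i).
  apply: satisfied_relation_mx => r; under eq_bigr do rewrite mxE.
  exact: int_mx_kernel_relation.
have rel a b c : l 0 a * l 0 b = l 0 c -> mu 0 a * mu 0 b = mu 0 c.
  move/eqP; rewrite -(satisfied_mul _ _ _ l0) => /(fintype.subsetP sub).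
  by rewrite satisfied_mul // => /eqP.
have relV a b : l 0 a * l 0 b = 1 -> mu 0 a * mu 0 b = 1.
  move/eqP; rewrite -(satisfied_inv _ _ l0) => /(fintype.subsetP sub).
  by rewrite satisfied_inv // => /eqP.
set T' := invmx P *m diag_mx mu *m P.
have aT' : is_aut (toC (structure_mx Gam)) T'.
  by apply: twist_is_aut PT _ rel => //; apply/is_aut_toC.
(* Reality of [T']: X = conj(P) P^-1 intertwines diag(l) with its conjugate, so a nonzero entry X_ab
   forces l_a l_b = 1. Then mu_a mu_b = 1 as well, and X intertwines diag(mu) with its conjugate.
   This is why the relations l_a l_b = 1 are imposed. *)
have [B BE] : exists B, T' = toC B.
  apply: conj_fixed_real; set Pc := map_mx conj P.
  have uPc : Pc \in unitmx by rewrite map_unitmx.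
  have PcT : Pc *m toC T = diag_mx (map_mx conj l) *m Pc.
    by rewrite -conj_toC -map_mxM PT map_mxM map_diag_mx.
  set X := Pc *m invmx P.
  have Xl : X *m diag_mx l = diag_mx (map_mx conj l) *m X.
    rewrite /X mulmxA -PcT -!mulmxA; congr (_ *m _).
    by rewrite -[RHS](mulKmx uP) (mulmxA P) PT mulmxK.
  have Xmu : X *m diag_mx mu = diag_mx (map_mx conj mu) *m X.
    clearbody X mu; apply/matrixP => a b; move/matrixP/(_ a b) : Xl.
    rewrite !mul_mx_diag !mul_diag_mx !mxE lJ muJ.
    have [->|X0] := eqVneq (X a b) 0; first by rewrite !mulr0 !mul0r.
    rewrite [RHS]mulrC [X in _ -> _ = X]mulrC => /(mulfI X0) lab; congr (_ * _).
    by apply: (mulfI (mu0 a)); rewrite mulfV // relV // lab mulfV.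
  have XP : X *m P = Pc by rewrite mulmxKV.
  have PcX : invmx Pc *m X = invmx P by rewrite mulKmx.
  rewrite !map_mxM map_invmx map_diag_mx /= -/Pc -[in X in _ *m X]XP mulmxA.
  by rewrite -(mulmxA _ _ X) -Xmu mulmxA PcX.
have uT' k' : T' ^+ k' = toC (B ^+ k').
  by rewrite BE toCX.
have uB : B \in unitmx.
  rewrite -(map_unitmx (real_complex R)) -BE /T' !unitmx_mul unitmx_inv uP andbT /=.
  by rewrite unitmxE det_diag unitfE; apply/prodf_neq0 => i _.
have aB : is_aut (structure_mx Gam) B by apply/is_aut_toC; rewrite -BE.
(* Squaring makes the determinant positive. *)
exists (B *m B).
  apply/GplusE; split; last exact: is_autM.
  by rewrite det_mulmx -expr2 exprn_even_gt0 //= -unitfE -unitmxE.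
move=> n n0 Bn.
have : T' ^+ (2 * n) = 1 by rewrite uT' exprM expr2 [B * B]/(B *m B) Bn [LHS]map_mx1.
rewrite conj_diagX // => /(congr1 (fun X => P *m X *m invmx P)).
rewrite !mulmxA mulmxV // mul1mx mulmxK // mulmx1 mulmxV // => /matrixP muE.
have [i vi] : exists i, v i 0 != 0.
  apply/existsP; rewrite -negb_forall; apply: contra v0 => /forallP h.
  by apply/eqP/matrixP => i j; rewrite ord1 mxE; apply/eqP.
have := wk (v i 0 * (2 * n)%:Z); rewrite mulf_neq0 //; last by lia.
have := muE i i; rewrite !mxE eqxx /= !mulr1n => e; rewrite -exprz_exp.
by rewrite -[X in X != _]/((w ^ v i 0) ^+ (2 * n)) e eqxx => /(_ isT).
Qed.

Theorem order_bound_exists m : exists b, order_bound R m b.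
Proof.
have /choice[d dP] : forall S : {set relation m}, exists d : nat,
    (exists2 v : 'cV[int]_m, v != 0 & relation_mx S *m v = 0) \/
    ((0 < d)%N /\ exists N, N *m relation_mx S = (d%:Z)%:M).
  move=> S; have [[v v0 Sv]|[d d0 dN]] := int_mx_kernel_or_inverse (relation_mx S).
    (* The value 0 is a placeholder: a kernel vector will contradict torsion. *)
    by exists 0; left; exists v.
  by exists d; right.
(* The sum over all sets of relations bounds each single [d S]. *)
exists (\sum_S d S)%N => p q _ Gam _ tors T GT.
have [n n0 Tn] : exists2 n, (0 < n)%N & T ^+ n = 1.
  apply: contrapT => h; apply: (tors T GT) => n n0 Tn.
  by apply: h; exists n.
have [P [l [uP PT ln]]] := finite_order_eigen n0 Tn.
set S := satisfied (fun i => l 0 i).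
case: (dP S) => [[v v0 Sv]|[d0 [N NS]]].
  have [T' GT' iT'] := kernel_infinite_order n0 GT uP PT ln Sv v0.
  by case: (tors T').
have l0 i : l 0 i != 0.
  by apply: contra_eq_neq (ln i) => ->; rewrite expr0n eqn0Ngt n0 eq_sym oner_eq0.
have ld i : l 0 i ^+ d S = 1.
  exact: (int_mx_inverse_torsion NS l0 (relation_mx_satisfied (fun i => l 0 i)) i).
have Td : T ^+ d S = 1.
  apply: (@map_mx_inj _ _ (real_complex R)); rewrite toCX [RHS]map_mx1.
  rewrite (_ : toC T = invmx P *m diag_mx l *m P); last by rewrite -mulmxA -PT mulKmx.
  rewrite conj_diagX // (_ : diag_mx _ = 1%:M) ?mulmx1 ?mulVmx //.
  by apply/matrixP => i j; rewrite !mxE ld.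
have exn : exists n, (0 < n)%N && (T ^+ n == 1) by exists n; rewrite n0 Tn eqxx.
case: (ex_minnP exn) => r /andP[r0 /eqP Tr] rmin.
exists r; first split => // j /andP[j0 jr] Tj.
  by have := rmin j; rewrite j0 Tj eqxx leqNgt jr => /(_ isT).
apply: (@leq_trans (d S)); first by apply: rmin; rewrite d0 Td eqxx.
by rewrite (bigD1 S) //= leq_addr.
Qed.

End OrderBound.

(** * Groups with elements of large order *)

Section Example.
Context {R : realType}.
Variable m : nat.
Hypothesis m_gt1 : (1 < m)%N.

(** With this value 1 + m beta = 4 is a square, so the Ricci form has an explicit inverse square
    root up to a scalar. *)
Definition example_beta : R := 3 / m%:R.
Local Notation beta := example_beta.

Definition example_christoffel : christoffel R m :=
  fun i j k => ((i == j) && (i == k))%:R + beta * (i == k)%:R.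
Local Notation Gam := example_christoffel.

Let x0 : m%:R != 0 :> R. Proof. by rewrite pnatr_eq0; lia. Qed.
Let beta0 : beta != 0. Proof. by rewrite mulf_neq0 ?invr_eq0 // pnatr_eq0. Qed.
Let mbeta : m%:R * beta = 3. Proof. by rewrite /beta mulrC divfK. Qed.

Let sum_delta n (F : 'I_n -> R) i : \sum_j (i == j)%:R * F j = F i.
Proof.
rewrite (bigD1 i) //= eqxx mul1r big1 ?addr0 // => j ji.
by rewrite eq_sym (negbTE ji) mul0r.
Qed.

Let sum_delta1 n (i : 'I_n) : \sum_j (i == j)%:R = 1 :> R.
Proof. by under eq_bigr do rewrite -[_%:R]mulr1; rewrite (sum_delta (fun=> 1)). Qed.

Let GamE i j k : Gam i j k = (i == k)%:R * ((i == j)%:R + beta).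
Proof.
rewrite /example_christoffel andbC -mulnb natrM.
by rewrite mulrDr [beta * _]mulrC.
Qed.

Let a0 : R := (m%:R - 1) * beta.
Let J : 'M[R]_m := const_mx 1.

Let JJ : J *m J = m%:R *: J.
Proof.
apply/matrixP => i j; rewrite !mxE.
under eq_bigr do rewrite !mxE mulr1.
by rewrite sumr_const card_ord mulr1.
Qed.

Lemma ricci_example : ricci Gam = a0 *: (1%:M + beta *: J).
Proof.
apply/matrixP => j k; rewrite !mxE mulr1.
under eq_bigr do rewrite sumrB; rewrite sumrB.
have -> : \sum_i \sum_n Gam i n i * Gam j k n = (1 + 3) * ((j == k)%:R + beta).
  rewrite exchange_big /=.
  under eq_bigr => n _.
    rewrite -mulr_suml (_ : \sum_i Gam i n i = 1 + 3); first over.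
    rewrite big_split /=; congr (_ + _).
      by under eq_bigr do rewrite eqxx andbT eq_sym; exact: sum_delta1.
    by under eq_bigr do rewrite eqxx mulr1; rewrite sumr_const card_ord -mbeta mulr_natl.
  rewrite -mulr_sumr; congr (_ * _); rewrite big_split /= -mulr_sumr sum_delta1 mulr1.
  congr (_ + _); have [->|jk] := eqVneq j k; last by rewrite big1.
  by rewrite sum_delta1.
have -> : \sum_i \sum_n Gam j n i * Gam i k n =
    (1 + beta) * ((j == k)%:R + beta).
  under eq_bigr => i _.
    under eq_bigr do rewrite GamE -mulrA; rewrite -mulr_sumr.
    over.
  rewrite (sum_delta (fun i => \sum_n ((j == n)%:R + beta) * Gam i k n)).
  under eq_bigr do rewrite mulrDl; rewrite big_split /= -mulr_sumr sum_delta.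
  under [in X in _ + X]eq_bigr do rewrite GamE.
  by rewrite -mulr_suml sum_delta1 mul1r GamE eqxx mul1r mulrDl mul1r.
rewrite /a0 -mulr_natr; move: mbeta; move: (beta) (_ == _)%:R => y t h.
by rewrite mulrBl h; ring.
Qed.

Lemma sym_ricci_example : sym_ricci Gam = a0 *: (1%:M + beta *: J).
Proof.
by apply/matrixP => j k; rewrite mxE ricci_example !mxE eq_sym -mulrDr; field.
Qed.

Lemma W_example : W 0 m Gam.
Proof.
have a0_gt0 : 0 < a0.
  by rewrite mulr_gt0 ?divr_gt0 // ?subr_gt0 ?ltr1n // ltr0n; lia.
(* On the all-ones vector 1 + beta J has eigenvalue 4 and 1 + b J has eigenvalue 1/2; on its
   orthogonal complement both are the identity. *)
pose b : R := - (2 * m%:R)^-1.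
pose s := (Num.sqrt a0)^-1.
pose P : 'M[R]_m := s *: (1%:M + b *: J).
have trP : P^T = P by apply/matrixP => i j; rewrite !mxE eq_sym.
have PSP : P *m sym_ricci Gam *m P^T = 1%:M.
  have -> : P *m sym_ricci Gam *m P^T = (s * a0 * s) *:
      ((1%:M + b *: J) *m (1%:M + beta *: J) *m (1%:M + b *: J)).
    rewrite trP sym_ricci_example -scalemxAr -!scalemxAl -scalemxAr scalerA.
    by rewrite -scalemxAl scalerA; congr (_ *: _); ring.
  have sas : s * a0 * s = 1.
    rewrite -[a0](sqr_sqrtr (ltW a0_gt0)) /s; field.
    by rewrite sqrtr_eq0 -ltNge.
  have mulJ x y : (1%:M + x *: J) *m (1%:M + y *: J) = 1%:M + (x + y + x * y * m%:R) *: J.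
    rewrite mulmxDl !mulmxDr !mul1mx mulmx1 -!scalemxAl -!scalemxAr JJ !scalerA.
    by rewrite -!addrA -!scalerDl; congr (_ + _ *: _); ring.
  have b0 : (b + beta + b * beta * m%:R) + b +
      (b + beta + b * beta * m%:R) * b * m%:R = 0.
    by rewrite /b /beta; field.
  by rewrite !mulJ b0 sas scale0r addr0 scale1r.
have [uP uSP] := mulmx1_unit (etrans (mulmxA _ _ _) PSP).
have [uS _] := mulmx1_unit (etrans (mulmxA _ _ _) (mulmx1C (etrans (mulmxA _ _ _) PSP))).
split => //; split=> //; exists P => //.
rewrite PSP; apply/matrixP => i j; by rewrite !mxE.
Qed.

Let colsum (T : 'M[R]_m) j := \sum_i T i j.

Lemma is_aut_example T : is_aut (structure_mx Gam) T <->
  forall i j c, T c i * T c j + beta * T c i * colsum T j =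
                (i == j)%:R * T c i + beta * T c i.
Proof.
rewrite is_autE.
have l i j c : \sum_a \sum_b Gam a b c * (T a i * T b j) =
   T c i * T c j + beta * T c i * colsum T j.
  under eq_bigr => a _.
    under eq_bigr do rewrite GamE eq_sym -mulrA; rewrite -mulr_sumr.
    over.
  rewrite (sum_delta (fun a => \sum_b ((a == b)%:R + beta) * (T a i * T b j))).
  under eq_bigr do rewrite mulrDl; rewrite big_split /= sum_delta; congr (_ + _).
  by rewrite /colsum mulr_sumr; apply: eq_bigr => b _; rewrite mulrA.
have r i j c : \sum_k T c k * Gam i j k = (i == j)%:R * T c i + beta * T c i.
  under eq_bigr do rewrite GamE mulrCA.
  by rewrite (sum_delta (fun k => T c k * ((i == j)%:R + beta))) mulrC mulrDl.
by split => h i j c; have := h i j c; rewrite l r.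
Qed.

(** If column j does not sum to 1, the equations for (i, j) and (j, i) make column i a multiple of
    column j, against invertibility. With all sums equal to 1, the equation for (i, i) says that
    every entry is idempotent. *)
Lemma aut_example_01 T : T \in unitmx -> is_aut (structure_mx Gam) T ->
  forall i j, T i j = (T i j == 1)%:R.
Proof.
move=> uT /is_aut_example aT.
have s1 j : colsum T j = 1.
  apply/eqP; rewrite -subr_eq0; apply/negP => /negP sj.
  have [i ij] : exists i : 'I_m, i != j.
    have [j0|j0] := eqVneq j (Ordinal (ltnW m_gt1)).
      by exists (Ordinal m_gt1); rewrite j0 -val_eqE.
    by exists (Ordinal (ltnW m_gt1)); rewrite eq_sym.
  pose t := (colsum T i - 1) / (colsum T j - 1).
  have Tt c : T c i = t * T c j.
    have h1 := aT i j c; have h2 := aT j i c.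
    move: h1 h2; rewrite (negbTE ij) eq_sym (negbTE ij) !mul0r !add0r => h1 h2.
    apply: (mulIf sj); rewrite /t mulrAC divfK //; apply: (mulfI beta0).
    by rewrite !mulrBr; move: h1 h2; lra.
  pose u : 'cV[R]_m := delta_mx i 0 - t *: delta_mx j 0.
  have : T *m u = 0.
    rewrite mulmxBr -scalemxAr -!colE; apply/colP => c.
    by rewrite !mxE Tt subrr.
  move/(congr1 (mulmx (invmx T))); rewrite mulKmx // mulmx0.
  move/colP/(_ i); rewrite !mxE eqxx (negbTE ij) /= mulr0 subr0 => /eqP.
  by rewrite oner_eq0.
move=> c i; have := aT i i c; rewrite s1 mulr1 eqxx mul1r => /addIr.
have [->|T0 e] := eqVneq (T c i) 0; first by rewrite eq_sym oner_eq0.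
by rewrite (_ : T c i = 1) ?eqxx //; apply: (mulfI T0); rewrite mulr1.
Qed.

(** Pigeonhole: all powers of [T] lie in the finite set of 0/1 matrices, so two of them coincide. *)
Lemma Gplus_example_torsion T : Gplus Gam T -> ~ infinite_order T.
Proof.
move=> GT inf.
pose A := {ffun 'I_m * 'I_m -> bool}.
pose f (k : 'I_#|A|.+1) : A := [ffun ij => (T ^+ k) ij.1 ij.2 == 1].
have /injectivePn[k1 [k2 k12 fk]] : ~~ injectiveb f.
  apply/negP => /injectiveP /leq_card; by rewrite card_ord ltnn.
have TE k i j : (T ^+ k) i j = ((T ^+ k) i j == 1)%:R.
  have Gk := GplusX k GT; apply: aut_example_01; first exact: Gplus_unit Gk.
  by case/GplusE: Gk.
have Tk : T ^+ k1 = T ^+ k2.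
  apply/matrixP => i j; rewrite TE [RHS]TE.
  by move/ffunP/(_ (i, j)): fk; rewrite !ffunE => ->.
have main a b : (a < b)%N -> T ^+ a = T ^+ b -> False.
  move=> ab e; apply: (inf (b - a)%N); first by rewrite subn_gt0.
  have uTa := Gplus_unit (GplusX a GT).
  have : T ^+ a *m T ^+ (b - a) = T ^+ a *m 1.
    by rewrite mulmxE -exprD subnKC ?(ltnW ab) // mulr1.
  by move/(congr1 (mulmx (invmx (T ^+ a)))); rewrite !mulKmx.
case: (ltngtP k1 k2) => [/main||/val_inj/eqP]; first exact.
- by move/main; apply.
- by rewrite (negbTE k12).
Qed.

Let rot : {perm 'I_m} := perm (@ordS_inj m).

Let rotX k i : val ((rot ^+ k)%g i) = ((i + k) %% m)%N.
Proof.
elim: k => [|k IH]; first by rewrite expg0 perm1 addn0 modn_small.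
by rewrite expgSr permM permE /= IH -addn1 modnDml addn1 addnS.
Qed.

Let perm_mxX (s : {perm 'I_m}) k : perm_mx s ^+ k = perm_mx (s ^+ k)%g :> 'M[R]_m.
Proof.
elim: k => [|k IH]; first by rewrite expr0 expg0 perm_mx1.
by rewrite exprS IH expgS perm_mxM.
Qed.

(** The square is taken because the cyclic shift may be an odd permutation. *)
Lemma Gplus_example_rot : Gplus Gam (perm_mx rot ^+ 2).
Proof.
have detp : \det (perm_mx rot : 'M[R]_m) != 0.
  by rewrite det_perm signr_eq0.
apply/GplusE; split.
  by rewrite expr2 det_mulmx -expr2 exprn_even_gt0.
apply: is_autX; apply/is_aut_example => i j c.
have -> : colsum (perm_mx rot) j = 1.
  rewrite /colsum (reindex_inj (@perm_inj _ rot^-1)%g) /=.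
  under eq_bigr do rewrite !mxE permKV.
  by under eq_bigr do rewrite eq_sym; exact: sum_delta1.
rewrite mulr1 !mxE; congr (_ + _).
by have [->|] := eqVneq (rot c) i; rewrite ?mul1r ?mulr1 ?mul0r ?mulr0 // eq_sym.
Qed.

(** If the squared shift has order n, then the shift by 2n fixes 0, so m divides 2n. *)
Lemma order_bound_example b : order_bound R m b -> (m <= b.*2)%N.
Proof.
move=> /(_ 0 m (add0n m) Gam W_example Gplus_example_torsion _ Gplus_example_rot).
move=> [n [n0 Tn _] nb].
have m0 : (0 < m)%N by apply: ltnW.
pose o := Ordinal m0.
have : (rot ^+ (2 * n))%g o = o.
  move: Tn; rewrite -exprM perm_mxX => /matrixP/(_ o o).
  by rewrite [RHS]mxE !mxE eqxx; case: eqP => // _ /eqP; rewrite eq_sym oner_eq0.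
move/(congr1 val); rewrite rotX /= add0n => /eqP d.
have := dvdn_leq _ d; rewrite muln_gt0 n0 => /(_ isT); lia.
Qed.

End Example.

Theorem theorem1p7 (R : realType) :
  (forall m p q : nat, (3 <= m)%N -> (p + q = m)%N ->
   forall (Gam_ : nat -> christoffel R m) (Gam : christoffel R m),
     (forall n, W p q (Gam_ n)) -> W p q Gam ->
     (forall i j k, Gam_ n i j k @[n --> \oo] --> Gam i j k) ->
     (forall n, (1 <= lie_dim (Gplus (Gam_ n)))%N) ->
     (1 <= lie_dim (Gplus Gam))%N)
  /\
  (exists c : nat -> nat,
     (forall m : nat, (3 <= m)%N ->
        order_bound R m (c m) /\
        (forall b : nat, order_bound R m b -> (c m <= b)%N)) /\
     c m @[m --> \oo] --> \oo).
Proof.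
split=> [m p q _ _ Gam_ Gam _ _|]; first exact: lie_dim_limit.
have /choice[c cP] : forall m, exists c, order_bound R m c /\
    forall b, order_bound R m b -> (c <= b)%N.
  move=> m; have [b mb] := @order_bound_exists R m.
  have exb : exists b, `[< order_bound R m b >] by exists b; apply/asboolP.
  case: (ex_minnP exb) => c /asboolP mc cmin; exists c; split => // b' mb'.
  by apply: cmin; apply/asboolP.
exists c; split=> [m _|]; first exact: cP.
(* The threshold ensures 1 < m for the example, and m <= 2 c(m) then gives M <= c(m). *)
apply/cvgnyPge => M; exists (M.*2.+2) => // m /= Mm.
have := @order_bound_example R m _ (c m) (cP m).1; lia.
Qed.
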